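(* There exists a commutative Fréchet-Arens-Michael algebra $A$ such that the trivial Fréchet $A$-module $\mathbb C=A_+/A$ is strictly flat, but $A$ does not have a bounded approximate identity. In addition, the underlying Fréchet space of $A$ is Montel.
   Context: All spaces are over $\mathbb C$. A Fréchet-Arens-Michael algebra is a Fréchet algebra whose topology is given by a family of submultiplicative seminorms. $A_+$ is the unitization of $A$ (an identity is always adjoined). A Fréchet space is Montel if each of its bounded subsets is relatively compact. A bounded approximate identity in $A$ is a net $(e_\alpha)$ with $\{e_\alpha\}$ bounded and $ae_\alpha\to a$, $e_\alpha a\to a$ for all $a\in A$. A (left or right) Fréchet $A$-module is a Fréchet space with a jointly continuous $A$-module structure. $\widehat\otimes$ is the completed projective tensor product. For a right Fréchet module $Y$ and a left Fréchet module $X$, $Y\mathbin{\widehat\otimes}_A X=(Y\mathbin{\widehat\otimes}X)/N$, where $N$ is the closed linear span of all $y\cdot a\otimes x-y\otimes a\cdot x$. A left Fréchet $A$-module $X$ is strictly flat if for every algebraically exact sequence $0\to Y_1\to Y_2\to Y_3\to0$ of right Fréchet $A$-modules (with continuous module maps) the sequence $0\to Y_1\mathbin{\widehat\otimes}_A X\to Y_2\mathbin{\widehat\otimes}_A X\to Y_3\mathbin{\widehat\otimes}_A X\to0$ is an exact sequence of vector spaces. *)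

(* Defs.v *)
From HB Require Import structures.
From mathcomp Require Import all_boot all_order all_algebra.
From mathcomp Require Export complex.
From mathcomp Require Import all_classical all_reals all_analysis.

Set Implicit Arguments.
Unset Strict Implicit.
Unset Printing Implicit Defensive.

Import Order.TTheory GRing.Theory Num.Theory.
Import numFieldNormedType.Exports.

Local Open Scope classical_set_scope.
Local Open Scope ring_scope.

Section Frechet.
Context {K : numFieldType}.
Implicit Types E F X Y Z T : tvsType K.

(* The uniform structure carried by a [tvsType] induces its topology but is   *)
(* not required to be translation invariant, so completeness is stated with   *)
(* the Cauchy filters of the underlying additive topological group.           *)
Definition lmod_cauchy E (F : set_system E) : Prop :=
  forall U : set E, nbhs 0 U ->
    exists2 B, F B & forall x y, B x -> B y -> U (x - y).

Definition lmod_complete E : Prop :=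
  forall F : set_system E, ProperFilter F -> lmod_cauchy F ->
    exists x : E, F --> x.

(* Metrizability of a Hausdorff topological vector space amounts to a         *)
(* countable base of neighbourhoods of the origin; local convexity is part of *)
(* [tvsType].                                                                 *)
Definition is_frechet E : Prop :=
  [/\ hausdorff_space E,
      exists U : nat -> set E, (forall n, nbhs 0 (U n)) /\
        (forall V : set E, nbhs 0 V -> exists n, U n `<=` V)
    & lmod_complete E].

Definition tvs_bounded E (B : set E) : Prop :=
  forall U : set E, nbhs 0 U -> exists t : K, B `<=` ( *:%R t @` U).

Definition montel E : Prop :=
  forall B : set E, tvs_bounded B -> compact (closure B).

Definition bilinear_map X Y Z (b : X -> Y -> Z) : Prop :=
  (forall x, linear (b x)) /\ (forall y, linear (b^~ y)).

Definition jointly_continuous X Y Z (b : X -> Y -> Z) : Prop :=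
  continuous (fun z : X * Y => b z.1 z.2).

Definition seminorm E (p : E -> K) : Prop :=
  [/\ forall x, 0 <= p x,
      forall x y, p (x + y) <= p x + p y
    & forall l x, p (l *: x) = `|l| * p x].

Definition topology_given_by E (P : set (E -> K)) : Prop :=
  forall U : set E, nbhs 0 U <->
    exists S : set (E -> K), exists e : K,
      [/\ finite_set S, S `<=` P, 0 < e
        & [set x | forall p, S p -> p x < e] `<=` U].

Definition lin_span E (S : set E) : set E :=
  [set t | exists n (c : 'I_n -> K) (s : 'I_n -> E),
     (forall i, S (s i)) /\ t = \sum_(i < n) c i *: s i].

(* [T], with [tau], is the completed projective tensor product of the Frechet *)
(* spaces [X] and [Y]: it linearizes the continuous bilinear maps from        *)
(* [X * Y] to Frechet spaces.  This determines [T] up to a unique             *)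
(* topological isomorphism compatible with [tau].                             *)
Definition is_projective_tensor X Y T (tau : X -> Y -> T) : Prop :=
  [/\ is_frechet T, bilinear_map tau, jointly_continuous tau
    & forall Z (b : X -> Y -> Z),
        is_frechet Z -> bilinear_map b -> jointly_continuous b ->
        exists! f : T -> Z,
          [/\ linear f, continuous f & forall x y, f (tau x y) = b x y]].

Definition short_exact (U V W : lmodType K) (f : U -> V) (g : V -> W) : Prop :=
  [/\ injective f, range f = [set v | g v = 0] & range g = setT].

(* Exactness of 0 -> U/L -> V/M -> W/N -> 0, where the maps are induced by    *)
(* [F] and [G], expressed on representatives.                                 *)
Definition short_exact_mod (U V W : lmodType K)
    (L : set U) (M : set V) (N : set W) (F : U -> V) (G : V -> W) : Prop :=
  [/\ forall u, M (F u) <-> L u,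
      forall v, N (G v) <-> exists u, M (v - F u)
    & forall w, exists v, N (w - G v)].

End Frechet.

Section Algebra.
Context {K : numFieldType} {A : tvsType K} (mul : A -> A -> A).
Implicit Types X Y T : tvsType K.

Definition frechet_algebra : Prop :=
  [/\ is_frechet A, bilinear_map mul, associative mul
    & jointly_continuous mul].

Definition frechet_arens_michael_algebra : Prop :=
  frechet_algebra /\
  exists P : set (A -> K),
    (forall p, P p ->
       seminorm p /\ forall a b, p (mul a b) <= p a * p b) /\
    topology_given_by P.

Definition left_frechet_module X (act : A -> X -> X) : Prop :=
  [/\ is_frechet X, bilinear_map act,
      forall a b x, act (mul a b) x = act a (act b x)
    & jointly_continuous act].

Definition right_frechet_module Y (act : Y -> A -> Y) : Prop :=
  [/\ is_frechet Y, bilinear_map act,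
      forall y a b, act y (mul a b) = act (act y a) b
    & jointly_continuous act].

Definition right_module_map Y1 Y2 (act1 : Y1 -> A -> Y1) (act2 : Y2 -> A -> Y2)
    (f : Y1 -> Y2) : Prop :=
  [/\ linear f, continuous f & forall y a, f (act1 y a) = act2 (f y) a].

(* The tensor product of [Y] and [X] over the algebra is the quotient of      *)
(* their completed projective tensor product [T] by this subspace.            *)
Definition balanced_kernel Y X T (actY : Y -> A -> Y) (actX : A -> X -> X)
    (tau : Y -> X -> T) : set T :=
  closure (lin_span
    [set t | exists y a x, t = tau (actY y a) x - tau y (actX a x)]).

(* [F] and [G] below are the maps [f (x) 1] and [g (x) 1].                    *)
Definition strictly_flat X (actX : A -> X -> X) : Prop :=
  left_frechet_module actX /\
  forall (Y1 Y2 Y3 : tvsType K) (act1 : Y1 -> A -> Y1)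
    (act2 : Y2 -> A -> Y2) (act3 : Y3 -> A -> Y3)
    (f : Y1 -> Y2) (g : Y2 -> Y3),
  right_frechet_module act1 -> right_frechet_module act2 ->
  right_frechet_module act3 ->
  right_module_map act1 act2 f -> right_module_map act2 act3 g ->
  short_exact f g ->
  forall (T1 T2 T3 : tvsType K) (tau1 : Y1 -> X -> T1)
    (tau2 : Y2 -> X -> T2) (tau3 : Y3 -> X -> T3)
    (F : T1 -> T2) (G : T2 -> T3),
  is_projective_tensor tau1 -> is_projective_tensor tau2 ->
  is_projective_tensor tau3 ->
  linear F -> continuous F -> (forall y x, F (tau1 y x) = tau2 (f y) x) ->
  linear G -> continuous G -> (forall y x, G (tau2 y x) = tau3 (g y) x) ->
  short_exact_mod (balanced_kernel act1 actX tau1)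
    (balanced_kernel act2 actX tau2) (balanced_kernel act3 actX tau3) F G.

Definition unitization_mul (u v : K^o * A) : K^o * A :=
  (u.1 * v.1, u.1 *: v.2 + v.1 *: u.2 + mul u.2 v.2).

(* The quotient of the unitization by [A] is identified with [K^o] through    *)
(* the first projection; [a] acts on the class of [c] by left multiplication  *)
(* in the unitization.                                                        *)
Definition trivial_act (a : A) (c : K^o) : K^o :=
  (unitization_mul (0, a) (c, 0)).1.

Definition directed (I : Type) (le : I -> I -> Prop) : Prop :=
  [/\ exists i : I, True, forall i, le i i,
      forall i j k, le i j -> le j k -> le i k
    & forall i j, exists k, le i k /\ le j k].

Definition net_filter (I : Type) (le : I -> I -> Prop) : set_system I :=
  [set S | exists i, forall j, le i j -> S j].

Definition has_bounded_approximate_identity : Prop :=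
  exists (I : Type) (le : I -> I -> Prop) (e : I -> A),
    [/\ directed le, tvs_bounded (range e),
        forall a, mul a (e i) @[i --> net_filter le] --> a
      & forall a, mul (e i) a @[i --> net_filter le] --> a].

End Algebra.

(* Every Frechet space [Y] is its own projective tensor product with the      *)
(* scalars, so the tensor products over which [strictly_flat] quantifies do   *)
(* exist for the trivial module.                                              *)
Lemma is_projective_tensor_scalars (K : numFieldType) (Y : tvsType K) :
  is_frechet Y -> is_projective_tensor (fun (y : Y) (c : K^o) => c *: y).
Proof.
move=> frY; split=> //.
- split=> [y k c d|c k y z]; first by rewrite scalerDl scalerA.
  by rewrite scalerDr !scalerA mulrC.
- move=> z; apply: (@continuous_comp (Y * K^o)%type (K^o * Y)%type Y
    (fun z => (z.2, z.1)) (fun z => z.1 *: z.2)).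
    by apply: (cvg_pair (G := nbhs z.2) (H := nbhs z.1)); [exact: cvg_snd|exact: cvg_fst].
  exact: scale_continuous.
- move=> Z b frZ [b1 b2] bc; exists (b^~ 1); split.
    split=> [||y c]; first exact: b2.
    + move=> y; apply: (@continuous_comp Y (Y * K^o)%type Z
        (fun y => (y, 1)) (fun z => b z.1 z.2)).
        by apply: (cvg_pair (G := nbhs y) (H := nbhs (1 : K^o)));
          [exact: cvg_id|exact: cvg_cst].
      exact: bc.
    + have scl (V W : lmodType K) (h : V -> W) : linear h ->
          forall k v, h (k *: v) = k *: h v.
        move=> hl k v; have h0 : h 0 = 0.
          have := hl 1 0 0; rewrite !scale1r addr0 => hh.
          by apply: (addrI (h 0)); rewrite addr0 -hh.
        by have := hl k v 0; rewrite !addr0 h0 addr0.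
      rewrite (scl _ _ (b^~ 1) (b2 1)) -(scl _ _ (b y) (b1 y)).
      by congr (b y _); exact: mulr1.
  move=> f [_ _ fb]; apply/funext => y.
  by rewrite -fb scale1r.
Qed.

(* Main.v *)
From HB Require Import structures.
Require Import Defs.
From mathcomp Require Import all_boot all_order all_algebra.
From mathcomp Require Import complex finmap.
From mathcomp Require Import all_classical all_reals all_analysis.
From mathcomp Require Import ring lra.

Set Implicit Arguments.
Unset Strict Implicit.
Unset Printing Implicit Defensive.

Import Order.TTheory GRing.Theory Num.Theory.
Import numFieldNormedType.Exports.

Local Open Scope classical_set_scope.
Local Open Scope ring_scope.

(** The algebra consists of the null sequences x : nat -> C, under pointwise
    multiplication, with sum_k a^n_k |x_(k+1) - x_k| finite for every n.  In the
    coordinates d_k = x_k - x_(k+1) it is a Koethe echelon space in which the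
    truncated units e_k = 1_[0,k] satisfy e_j e_k = e_(min j k).  The weights
    are chosen so that

    - for each n, a^n is bounded on infinitely many k, so that for every
      neighbourhood O of 0 some multiple of O contains e_k for arbitrarily large k;
    - a set on which all the seminorms are bounded has uniformly small tails.

    The second property makes A a Montel space.  It also forbids a bounded
    approximate identity: the k-th coordinates of a bounded set are small for
    large k, while those of an approximate identity tend to 1.

    For the trivial module, the tensor product of Y with C over A is
    Y / cl(YA).  The elements w with w e_k = w for all large k are dense in
    cl(YA), and the first property controls the action of e_k on a given
    neighbourhood.  Given an exact sequence with maps f and g, this yields
    f^-1(cl(Y2 A)) = cl(Y1 A) directly, since f is a homeomorphism onto its
    range.  It also shows that g : cl(Y2 A) -> cl(Y3 A) is nearly open, hence
    onto by the successive approximations of the open mapping theorem. *)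

(** * Linear maps, neighbourhoods of the origin and subspaces *)

Section LinearMaps.
Context {K : numFieldType} {U V : lmodType K} (f : U -> V).
Hypothesis fl : linear f.

Lemma lin0 : f 0 = 0.
Proof.
have := fl 1 0 0; rewrite !scale1r addr0 => h.
by apply: (addrI (f 0)); rewrite addr0 -h.
Qed.

Lemma linZ k x : f (k *: x) = k *: f x.
Proof. by have := fl k x 0; rewrite !addr0 lin0 addr0. Qed.

Lemma linD x y : f (x + y) = f x + f y.
Proof. by have := fl 1 x y; rewrite !scale1r. Qed.

Lemma linB x y : f (x - y) = f x - f y.
Proof. by rewrite linD -scaleN1r linZ scaleN1r. Qed.

End LinearMaps.

Section Neighbourhoods.
Context {K : numFieldType}.
Implicit Types E F : tvsType K.

Lemma nbhs0_sub E (U : set E) : nbhs 0 U ->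
  exists2 V, nbhs 0 V & forall x y, V x -> V y -> U (x - y).
Proof.
move=> U0; have /= := @sub_continuous E (0, 0) U.
rewrite subrr => /(_ U0) [[V W] /= [V0 W0] VW].
exists (V `&` W); first exact: filterI.
by move=> x y [Vx _] [_ Wy]; exact: (VW (x, y)).
Qed.

Lemma nbhs0_opp E (U : set E) : nbhs 0 U -> nbhs 0 [set x | U (- x)].
Proof.
move=> U0; have := @opp_continuous E 0; rewrite /continuous_at oppr0.
by apply.
Qed.

Lemma nbhs0_half E (U : set E) : nbhs 0 U -> exists V, [/\ nbhs 0 V,
  forall x, V x -> V (- x) & forall x y, V x -> V y -> U (x + y)].
Proof.
move=> /nbhs0_sub [V V0 VU]; exists (V `&` [set x | V (- x)]); split.
- by apply: filterI => //; exact: nbhs0_opp.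
- by move=> x [Vx Vnx]; split => //=; rewrite opprK.
- by move=> x y [Vx _] [_ Vy]; rewrite -[y]opprK; exact: VU.
Qed.

Lemma nbhs_shift E (x : E) (U : set E) : nbhs x U <-> nbhs 0 [set y | U (x + y)].
Proof.
split=> [xU|U0].
  have := nbhsB (- x) xU; rewrite addNr; apply: filterS => _ [z Uz <-] /=.
  by rewrite addrA subrr add0r.
have := nbhsB x U0; rewrite addr0; apply: filterS => _ [z Uz <-] //.
Qed.

Lemma nbhs0_scale E (U : set E) (k : K) : nbhs 0 U -> nbhs 0 [set x | U (k *: x)].
Proof.
move=> U0; have /= := @scale_continuous K E (k, 0) U.
rewrite scaler0 => /(_ U0) [[V W] /= [V0 W0] VW].
by apply: filterS W0 => y Wy; apply: (VW (k, y)); split => //; exact: nbhs_singleton.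
Qed.

Lemma nbhs0_absorb E (U : set E) (x : E) :
  nbhs 0 U -> nbhs (0 : K^o) [set k | U (k *: x)].
Proof.
move=> U0; have /= := @scale_continuous K E (0, x) U.
rewrite scale0r => /(_ U0) [[V W] /= [V0 W0] VW].
by apply: filterS V0 => y Vy; apply: (VW (y, x)); split => //; exact: nbhs_singleton.
Qed.

Lemma nbhs0_absorb_neq0 E (U : set E) (x : E) :
  nbhs 0 U -> exists2 k : K, k != 0 & U (k *: x).
Proof.
move=> /(nbhs0_absorb x) /nbhs_ballP [e /= e0 eU]; exists (e / 2).
  by rewrite gt_eqF // divr_gt0.
apply: eU; rewrite -ball_normE /= sub0r normrN gtr0_norm ?divr_gt0//.
by rewrite ltr_pdivrMr // ltr_pMr // ltr1n.
Qed.

Lemma closure0P E (A : set E) (x : E) :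
  closure A x <-> forall U, nbhs 0 U -> exists2 a, A a & U (a - x).
Proof.
split=> [clx U U0|clx B /nbhs_shift /clx [a Aa]].
  have /clx [a [Aa Ua]] : nbhs x [set a | U (a - x)].
    by apply/nbhs_shift; apply: filterS U0 => y /=; rewrite addrAC subrr add0r.
  by exists a.
by rewrite /= addrC subrK => Ba; exists a.
Qed.

Lemma continuous_linear0 E F (f : E -> F) (U : set F) : linear f -> continuous f ->
  nbhs 0 U -> nbhs 0 [set x | U (f x)].
Proof. by move=> fl /(_ 0) fc U0; apply: fc; rewrite /= lin0. Qed.

Lemma cvg0P E (F : set_system E) {FF : Filter F} (x : E) :
  F --> x <-> forall U, nbhs 0 U -> F [set y | U (y - x)].
Proof.
split=> [Fx U U0|H B /nbhs_shift /H].
  by apply: Fx; apply/nbhs_shift; apply: filterS U0 => y /=; rewrite addrAC subrr add0r.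
by apply: filterS => y /=; rewrite addrC subrK.
Qed.

Definition subspace E (W : set E) :=
  W 0 /\ forall (k : K) x y, W x -> W y -> W (k *: x + y).

Lemma subspaceD E (W : set E) x y : subspace W -> W x -> W y -> W (x + y).
Proof. by move=> [_ Wc] Wx Wy; rewrite -[x]scale1r; exact: Wc. Qed.

Lemma subspaceZ E (W : set E) k x : subspace W -> W x -> W (k *: x).
Proof. by move=> [W0 Wc] Wx; rewrite -[_ *: _]addr0; exact: Wc. Qed.

Lemma subspaceB E (W : set E) x y : subspace W -> W x -> W y -> W (x - y).
Proof. by move=> Ws Wx Wy; apply: subspaceD => //; rewrite -scaleN1r; exact: subspaceZ. Qed.

Lemma subspace_sum E (W : set E) n (c : 'I_n -> K) (s : 'I_n -> E) :
  subspace W -> (forall i, W (s i)) -> W (\sum_(i < n) c i *: s i).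
Proof.
move=> Ws; elim: n c s => [|n IHn] c s Wi; first by rewrite big_ord0; case: Ws.
by rewrite big_ord_recr /=; apply: subspaceD => //; [exact: IHn|exact: subspaceZ].
Qed.

Lemma subspace_setT E : subspace (@setT E).
Proof. by []. Qed.

Lemma subspace_closure E (W : set E) : subspace W -> subspace (closure W).
Proof.
move=> Ws; split=> [|k x y]; first by apply: subset_closure; case: Ws.
move=> /closure0P Wx /closure0P Wy; apply/closure0P => U.
move=> /nbhs0_half [V [V0 _ VU]].
have [a Wa Va] := Wx _ (nbhs0_scale k V0); have [b Wb Vb] := Wy _ V0.
exists (k *: a + b); first by case: Ws => _; apply.
rewrite opprD addrACA -scalerBr; exact: VU.
Qed.

Lemma subspace_lin_span E (S : set E) : subspace (lin_span S).
Proof.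
split.
  exists 0, (fun=> 0), (fun=> 0); split; first by case.
  by rewrite big_ord0.
move=> k _ _ [m [c [s [Ss ->]]]] [n [d [t [St ->]]]].
exists (m + n)%N, (fun i => match fintype.split i with inl j => k * c j | inr j => d j end),
  (fun i => match fintype.split i with inl j => s j | inr j => t j end); split.
  by move=> i; case: (fintype.split i).
rewrite big_split_ord /= scaler_sumr; congr (_ + _); apply: eq_bigr => i _.
  by rewrite -[lshift n i]/(unsplit (inl i)) unsplitK scalerA.
by rewrite -[rshift m i]/(unsplit (inr i)) unsplitK.
Qed.

Lemma sub_lin_span E (S : set E) : S `<=` lin_span S.
Proof.
move=> x Sx; exists 1%N, (fun=> 1), (fun=> x); split => //.
by rewrite big_ord1 scale1r.
Qed.

Lemma lin_span_sub E (S W : set E) : subspace W -> S `<=` W -> lin_span S `<=` W.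
Proof. by move=> Ws SW _ [n [c [s [Ss ->]]]]; apply: subspace_sum => // i; exact: SW. Qed.

End Neighbourhoods.
(** * Open mappings between Frechet spaces *)

Section OpenMapping.
Context {K : numFieldType}.
Implicit Types E F : tvsType K.

(** Stands in for a translation-invariant metric: [B n] acts as the ball of radius 2^-n. *)
Definition nbhs_chain E (B : nat -> set E) :=
  [/\ forall n, nbhs 0 (B n), forall n x, B n x -> B n (- x),
      forall n x y, B n.+1 x -> B n.+1 y -> B n (x + y)
    & forall V, nbhs 0 V -> exists n, B n `<=` V].

Lemma frechet_chain E : is_frechet E -> exists B : nat -> set E, nbhs_chain B.
Proof.
move=> [_ [U [U0 Ub]] _].
have /choice [half halfP] : forall V : set E, exists W : set E, nbhs 0 V ->
    [/\ nbhs 0 W, forall x, W x -> W (- x)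
      & forall x y, W x -> W y -> V (x + y)].
  move=> V.
  have [/nbhs0_half [W VW]|nV] := pselect (nbhs 0 V); first by exists W.
  by exists V.
pose B := fix B n := if n is k.+1 then half (B k `&` U k.+1) else half (U 0%N).
have B0 n : nbhs 0 (B n).
  elim: n => [|n IHn] /=; first by case: (halfP _ (U0 0%N)).
  by have [] := halfP (B n `&` U n.+1) (filterI IHn (U0 _)).
exists B; split => //.
- case=> [|n] x; first by case: (halfP _ (U0 0%N)) => _ + _; apply.
  by case: (halfP (B n `&` U n.+1) (filterI (B0 _) (U0 _))) => _ + _; apply.
- move=> n x y Bx By.
  by case: (halfP (B n `&` U n.+1) (filterI (B0 _) (U0 _))) => _ _ /(_ x y Bx By) [].
- move=> V /Ub [n UV]; exists n => x Bx; apply: UV.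
  have [W [W0 Wx BW]] : exists W, [/\ nbhs 0 W, W x & forall y, W y -> W 0 -> U n y].
    case: n Bx => [|n] Bx.
      exists (B 0%N); split => // y By B00; rewrite -[y]addr0.
      by case: (halfP _ (U0 0%N)) => _ _; apply.
    exists (B n.+1); split => // y By B00; rewrite -[y]addr0.
    by case: (halfP (B n `&` U n.+1) (filterI (B0 _) (U0 _))) => _ _ /(_ y 0 By B00) [].
  by apply: BW => //; exact: nbhs_singleton.
Qed.

Lemma chain_le E (B : nat -> set E) m n : nbhs_chain B -> (m <= n)%N -> B n `<=` B m.
Proof.
move=> [B0 _ BD _]; elim: n => [|n IHn]; first by rewrite leqn0 => /eqP ->.
rewrite leq_eqVlt => /orP [/eqP -> //|/IHn nm] x Bx; apply: nm.
by rewrite -[x]addr0; apply: BD => //; exact: nbhs_singleton.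
Qed.

(** By telescoping, the differences [s (n + j) - s n] stay in [B (m n).+1]; one more halving absorbs
    the passage to the limit. A general increasing [m] lets the radii be chosen during the
    construction, as in the Baire argument. *)
Lemma chain_series E (B : nat -> set E) (m : nat -> nat) (s : nat -> E) :
  lmod_complete E -> nbhs_chain B -> (forall n, (m n < m n.+1)%N) ->
  (forall n, B (m n).+2 (s n.+1 - s n)) ->
  exists2 x, s @ \oo --> x & forall n, B (m n) (x - s n).
Proof.
move=> cE Bc mS sB; have [B0 BN BD BV] := Bc.
have tailB j n : B (m n).+1 (s (n + j)%N - s n).
  elim: j n => [|j IHj] n; first by rewrite addn0 subrr; exact: nbhs_singleton.
  rewrite -[s _ - s n](subrKA (s n.+1)) -addSnnS; apply: BD => //.
  by apply: chain_le (IHj n.+1) => //; rewrite ltnS.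
have m_ge n : (n <= m n)%N by elim: n => // n IHn; exact: leq_ltn_trans (mS n).
have [|x sx] := cE (s @ \oo).
  move=> U /nbhs0_sub [V V0 VU]; have [n BVn] := BV _ V0.
  exists [set y | B n (y - s n)].
    exists n => // k /= nk; rewrite -(subnKC nk).
    by apply: chain_le (tailB _ n) => //; exact: leqW.
  move=> y z /BVn By /BVn Bz.
  by have := VU _ _ By Bz; rewrite opprB addrA subrK.
exists x => // n; have /cvg0P /(_ _ (B0 (m n).+1)) [k _ sxk] := sx.
have /= := sxk (n + k)%N (leq_addl _ _) => /BN; rewrite opprB => Bx.
by rewrite -[x - _](subrKA (s (n + k)%N)); exact: BD.
Qed.

(** Successive approximations: an error in [V n] and [L] is matched by the image of a vector of
    [B' n.+2] and [W], up to an error in [V n.+1]. The subspaces allow an application to maps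
    between closed spans. *)
Lemma near_open_open E F (g : E -> F) (W : set E) (L : set F) :
  is_frechet E -> hausdorff_space F -> linear g -> continuous g ->
  subspace W -> closed W -> subspace L -> (forall x, W x -> L (g x)) ->
  (forall U, nbhs 0 U -> exists2 V, nbhs 0 V & V `&` L `<=` closure (g @` (U `&` W))) ->
  forall U, nbhs 0 U -> exists2 V, nbhs 0 V & V `&` L `<=` g @` (U `&` W).
Proof.
move=> frE hF gl gc Ws Wcl Ls gWL near_open U U0.
have [B Bc] := frechet_chain frE; have [B0 BN BD BV] := Bc.
have [_ _ cE] := frE.
have [n0 BU] := BV _ U0.
pose B' n := B (n0 + n)%N.
have B'c : nbhs_chain B'.
  split=> [n|n|n x y|V /BV [n BnV]]; rewrite /B' ?addnS //; first exact: BN.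
    exact: BD.
  by exists n => x Bx; apply: BnV; apply: chain_le Bx => //; exact: leq_addl.
have /choice [V VP] : forall n, exists V : set F, nbhs 0 V /\
    V `&` L `<=` closure (g @` (B' n.+2 `&` W)).
  move=> n; by have [V V0 VL] := near_open _ (B0 (n0 + n.+2)%N); exists V.
exists (V 0%N) => [|w [Vw Lw]]; first by case: (VP 0%N).
(* The invariant is an antecedent, so that [step] is total; its value elsewhere is arbitrary. *)
have /choice [step stepP] : forall z : nat * E, exists f, W z.2 ->
    V z.1 (w - g z.2) -> [/\ B' z.1.+2 (f - z.2), W f & V z.1.+1 (w - g f)].
  move=> [n z] /=.
  have [[Wz Vz]|nWV] := pselect (W z /\ V n (w - g z)); last first.
    by exists z => Wz Vz; case: nWV.
  have [Vn0 Vcl] := VP n; have [Vn1 _] := VP n.+1.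
  have Lz : L (w - g z) by apply: subspaceB => //; exact: gWL.
  have /closure0P /(_ _ (nbhs0_opp Vn1)) [_ [x [Bx Wx] <-] /= Vx] := Vcl _ (conj Vz Lz).
  exists (z + x) => _ _; split.
  - by rewrite addrAC subrr add0r.
  - exact: subspaceD.
  - by rewrite linD // opprD addrA -opprB.
pose s := fix s n := if n is k.+1 then step (k, s k) else 0.
have sP n : W (s n) /\ V n (w - g (s n)).
  elim: n => [|n [IW IV]] /=; first by rewrite lin0 // subr0; split => //; case: Ws.
  by have [] := stepP (n, s n) IW IV.
have sB n : B' n.+2 (s n.+1 - s n).
  by have [IW IV] := sP n; have [] := stepP (n, s n) IW IV.
have [x sx xB] := chain_series cE B'c ltnSn sB.
exists x; first split.
- by apply: BU; have := xB 0%N; rewrite /= subr0 /B' addn0.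
- apply: (closed_cvg W Wcl _ x sx); apply: filterE => n; exact: (sP n).1.
- have gx : g \o s @ \oo --> g x by apply: cvg_comp sx _; exact: gc.
  (* The sets [V n] need not shrink to 0. The error [w - g (s k)] is small because it lies in the
     closure of the image of [B' k.+2], and [g] is continuous. *)
  have gw : g \o s @ \oo --> w; last exact: (cvg_unique hF gx gw).
  apply/cvg0P => Q /nbhs0_half [Q' [Q0 QN QQ]].
  have [n BQ] : exists n, B' n `<=` [set x | Q' (g x)].
    by have [_ _ _] := B'c; apply; exact: continuous_linear0.
  exists n => // k /= nk; rewrite -opprB.
  have [Wk Vk] := sP k; have [_ Vcl] := VP k.
  have Lk : L (w - g (s k)) by apply: subspaceB => //; exact: gWL.
  have /closure0P /(_ _ Q0) [_ [y [By Wy] <-] Qy] := Vcl _ (conj Vk Lk).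
  have Qgy : Q' (g y).
    by apply: BQ; apply: chain_le By => //; exact: leq_trans (leqW _).
  have -> : - (w - g (s k)) = (g y - (w - g (s k))) + (- g y).
    by rewrite addrAC subrr add0r.
  by apply: QQ => //; exact: QN.
Qed.

(** If no [C n] had interior relative to [L], one could choose balls centred in [L], the n-th
    missing [C n], whose centres converge to a point of [L] outside every [C n]. *)
Lemma baire_subspace F (L : set F) (C : nat -> set F) :
  is_frechet F -> closed L -> L 0 -> (forall n, closed (C n)) ->
  L `<=` \bigcup_n C n ->
  exists n x V, [/\ L x, nbhs 0 V & forall y, L y -> V (y - x) -> C n y].
Proof.
move=> frF Lc L0 Cc LC; apply: contrapT => nP.
have [B Bc] := frechet_chain frF; have [B0 BN BD BV] := Bc.
have [_ _ cF] := frF.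
have /choice [step stepP] : forall z : nat * (F * nat), exists f, L z.2.1 ->
    [/\ B z.2.2.+2 (f.1 - z.2.1), L f.1, (z.2.2 < f.2)%N
      & forall y, B f.2 (y - f.1) -> ~ C z.1 y].
  move=> [n [x m]] /=.
  have [Lx|nLx] := pselect (L x); last by exists (x, m).
  have [y Ly [By nCy]] : exists2 y, L y & B m.+2 (y - x) /\ ~ C n y.
    apply: contrapT => nex; apply: nP; exists n, x, (B m.+2); split => // y Ly By.
    by apply: contrapT => nC; apply: nex; exists y.
  have yC : nbhs y (~` C n) by apply: open_nbhs_nbhs; split => //; exact: closed_openC.
  have [k Bk] := BV _ ((nbhs_shift _ _).1 yC).
  exists (y, maxn m.+1 k) => _; split => //=; first by rewrite leq_max ltnSn.
  move=> z Bz; have /= := Bk (z - y); rewrite (addrC y) subrK; apply.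
  by apply: chain_le Bz => //; rewrite leq_max leqnn orbT.
pose s := fix s n := if n is k.+1 then step (k, s k) else (0, 0%N).
have sL n : L (s n).1.
  by elim: n => [|n IHn] //=; have [] := stepP (n, s n) IHn.
have sP n := stepP (n, s n) (sL n).
have [||x sx xB] := @chain_series F B (fun n => (s n).2) (fun n => (s n).1) cF Bc.
- by move=> n; have [] := sP n.
- by move=> n; have [] := sP n.
have Lx : L x by apply: (closed_cvg L Lc _ x sx); exact: filterE.
have [n _ Cx] := LC _ Lx.
(* The ball that avoids [C n] is the one of stage [n.+1]. *)
by have [_ _ _ /(_ x) /= nC] := sP n; apply: nC Cx; exact: (xB n.+1).
Qed.

End OpenMapping.

Lemma hausdorff_frechet {K : numFieldType} (E : tvsType K) :
  is_frechet E -> hausdorff_space E.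
Proof. by case. Qed.

Section ClosedRange.
Context {K : numFieldType}.
Hypothesis invn_cvg0 : (fun n => n.+1%:R^-1 : K^o) @ \oo --> (0 : K^o).
Implicit Types E F : tvsType K.

(** The archimedean hypothesis on [K] enters here: integer multiples of a neighbourhood cover the
    space, which gives Baire a countable cover. *)
Lemma nbhs0_absorb_nat E (U : set E) (x : E) :
  nbhs 0 U -> exists n, U (n.+1%:R^-1 *: x).
Proof.
by move=> /(nbhs0_absorb x) /invn_cvg0 [n _ nU]; exists n; exact: (nU n (leqnn n)).
Qed.

(** The open mapping theorem onto a closed range. By Baire, the image of some multiple of [W] is
    dense near a point [x] of the range; taking differences moves this to the origin. *)
Lemma closed_range_open E F (f : E -> F) :
  is_frechet E -> is_frechet F -> linear f -> continuous f -> closed (range f) ->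
  forall U, nbhs 0 U -> exists2 V, nbhs 0 V & V `&` range f `<=` f @` U.
Proof.
move=> frE frF fl fc fcl.
have fs : subspace (range f).
  split=> [|k _ _ [x _ <-] [y _ <-]]; first by exists 0 => //; rewrite lin0.
  by exists (k *: x + y) => //; rewrite fl.
suff near_open U : nbhs 0 U ->
    exists2 V, nbhs 0 V & V `&` range f `<=` closure (f @` (U `&` setT)).
  move=> U U0; have [V V0 VU] := near_open_open frE (hausdorff_frechet frF) fl fc
    (@subspace_setT _ E) closedT fs (fun x _ => ex_intro2 _ _ x I erefl) near_open U0.
  by exists V => // y /VU [x [Ux _] <-]; exists x.
move=> U0; have [W W0 WU] := nbhs0_sub U0.
pose C n := closure [set f (n.+1%:R *: u) | u in W].
have [|||] := baire_subspace (C := C) frF fcl.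
- by case: fs.
- by move=> n; exact: closed_closure.
- move=> _ [x _ <-]; have [n Wx] := nbhs0_absorb_nat x W0.
  exists n => //; apply: subset_closure; exists (n.+1%:R^-1 *: x) => //.
  by rewrite scalerA mulfV ?pnatr_eq0 // scale1r.
move=> n [x [V [Lx V0 VC]]].
exists [set y | V (n.+1%:R *: y)]; first exact: nbhs0_scale.
(* Both [n.+1 y + x] and [x] lie in [C n]. Approximating both and dividing the difference by [n.+1]
   approximates [y] by [f (u - v)]. *)
move=> y [/= Vy Ly]; apply/closure0P => Q /(nbhs0_scale n.+1%:R^-1) /nbhs0_sub [Q' Q0 QQ].
have /closure0P /(_ _ Q0) [_ [u Wu <-] Qu] : C n (n.+1%:R *: y + x).
  apply: VC; last by rewrite addrK.
  by case: fs => _; apply.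
have /closure0P /(_ _ Q0) [_ [v Wv <-] Qv] : C n x.
  by apply: VC => //; rewrite subrr; exact: nbhs_singleton.
exists (f (u - v)); first by exists (u - v) => //; split => //; exact: WU.
have := QQ _ _ Qu Qv; rewrite /= !(linZ fl) opprD addrA opprB subrKA addrAC.
rewrite -!scalerBr -linB //.
by rewrite scalerA mulVf ?pnatr_eq0 // scale1r.
Qed.

End ClosedRange.

Section ClosedSpan.
Context {K : numFieldType}.
Implicit Types E F : tvsType K.

Lemma closed_span_map E F (f : E -> F) (S : set E) (W : set F) :
  linear f -> continuous f -> subspace W -> closed W -> (forall s, S s -> W (f s)) ->
  forall x, closure (lin_span S) x -> W (f x).
Proof.
move=> fl fc Ws Wc SW x.
have -> : W (f x) = (f @^-1` W) x by [].
have Pc : closed (f @^-1` W) by apply: closed_comp Wc => y _; exact: fc.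
rewrite ((closure_id _).1 Pc); move: x; apply: closure_subset.
apply: lin_span_sub => //; split; first by rewrite /= lin0 //; case: Ws.
by move=> k y z Wy Wz; rewrite /= fl; case: Ws => _; apply.
Qed.

Lemma subspace_closed_span E (S : set E) : subspace (closure (lin_span S)).
Proof. by apply: subspace_closure; exact: subspace_lin_span. Qed.

Lemma closed_span_sub E (S : set E) : S `<=` closure (lin_span S).
Proof. by move=> x Sx; apply: subset_closure; exact: sub_lin_span. Qed.

End ClosedSpan.

(** * Flatness of the trivial module *)

Section Flatness.
Context {K : numFieldType}.
Hypothesis invn_cvg0 : (fun n => n.+1%:R^-1 : K^o) @ \oo --> (0 : K^o).
Context {A : tvsType K} (mul : A -> A -> A) (e : nat -> A).
(** These two hypotheses replace a bounded approximate identity. In [e_small] the scalar [t] depends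
    on [O] alone, but the admissible indices [k] vary with [O], so the [e k] need not be bounded. *)
Hypothesis e_dense : forall a,
  closure [set d | exists k0, forall k, (k0 <= k)%N -> mul d (e k) = d] a.
Hypothesis e_small : forall O : set A, nbhs 0 O ->
  exists2 t : K, t != 0 & forall k0, exists2 k, (k0 <= k)%N & O (t *: e k).
Implicit Types Y : tvsType K.

Definition orbit_span Y (act : Y -> A -> Y) : set Y :=
  closure (lin_span [set t | exists y a, t = act y a]).

Definition eventually_fixed Y (act : Y -> A -> Y) : set Y :=
  [set w | exists k0, forall k, (k0 <= k)%N -> act w (e k) = w].

Lemma orbit_span_act Y (act : Y -> A -> Y) y a : orbit_span act (act y a).
Proof. by apply: closed_span_sub; exists y, a. Qed.

Lemma orbit_span_map Y1 Y2 (act1 : Y1 -> A -> Y1) (act2 : Y2 -> A -> Y2) f y :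
  right_module_map act1 act2 f -> orbit_span act1 y -> orbit_span act2 (f y).
Proof.
move=> [fl fc fa]; apply: closed_span_map => //.
- exact: subspace_closed_span.
- exact: closed_closure.
- by move=> _ [z [a ->]]; rewrite fa; exact: orbit_span_act.
Qed.

Lemma act_small Y (act : Y -> A -> Y) (U : set Y) :
  right_frechet_module mul act -> nbhs 0 U ->
  exists V O, [/\ nbhs 0 V, nbhs 0 O & forall y a, V y -> O a -> U (act y a)].
Proof.
move=> [_ [actl _] _ actc] U0; have /= := actc (0, 0) U.
rewrite (lin0 (actl 0)) => /(_ U0) [[V O] /= [V0 O0] VO].
by exists V, O; split => // y a Vy Oa; exact: (VO (y, a)).
Qed.

(** Writing [y e_k] as [(t^-1 y)(t e_k)] makes [V] independent of [k]. The index must be available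
    beyond any bound because it is chosen after a vector that only late [e k] fix. *)
Lemma act_unit_small Y (act : Y -> A -> Y) (U : set Y) :
  right_frechet_module mul act -> nbhs 0 U ->
  exists2 V, nbhs 0 V & forall k0, exists2 k, (k0 <= k)%N &
    forall y, V y -> U (act y (e k)).
Proof.
move=> Ym /(act_small Ym) [V [W [V0 W0 VW]]].
have [t t0 te] := e_small W0; have [_ [actl actr] _ _] := Ym.
exists [set y | V (t^-1 *: y)] => [|k0]; first exact: nbhs0_scale.
have [k k0k Ok] := te k0; exists k => // y /VW /(_ Ok).
by rewrite (linZ (actr _)) (linZ (actl _)) scalerA mulVf // scale1r.
Qed.

Lemma subspace_eventually_fixed Y (act : Y -> A -> Y) :
  right_frechet_module mul act -> subspace (eventually_fixed act).
Proof.
move=> [_ [_ actr] _ _]; split.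
  by exists 0%N => k _; rewrite (lin0 (actr _)).
move=> c x y [m mx] [n ny]; exists (maxn m n) => k.
by rewrite geq_max => /andP[mk nk]; rewrite (actr _) mx // ny.
Qed.

(** A generator [y a] is close to some [y d] with [d] from [e_dense], and
    [(y d) e_k = y (d e_k) = y d] for large [k]. *)
Lemma orbit_span_dense Y (act : Y -> A -> Y) :
  right_frechet_module mul act -> orbit_span act `<=` closure (eventually_fixed act).
Proof.
move=> Ym; have [_ [actl _] actA actc] := Ym.
rewrite [X in _ `<=` X](closure_id _).1; last exact: closed_closure.
apply: closure_subset; apply: lin_span_sub.
  exact/subspace_closure/subspace_eventually_fixed.
move=> _ [y [a ->]]; apply/closure0P => U U0.
have [V [W [V0 W0 VW]]] := act_small Ym U0.
(* [y] is scaled into [V] by [t]; the factor [t^-1] goes onto [d - a]. *)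
have [t t0 Vt] := nbhs0_absorb_neq0 y V0.
have /closure0P /(_ _ (nbhs0_scale t^-1 W0)) [d [k0 kd] Od] := @e_dense a.
exists (act y d); first by exists k0 => k k0k; rewrite -actA kd.
rewrite -(linB (actl y)); have := VW _ _ Vt Od.
have [_ [_ actr] _ _] := Ym.
by rewrite (linZ (actr _)) (linZ (actl _)) scalerA mulfV // scale1r.
Qed.

(** The vectors [u e_k] come close to [u]: with [w] near [f u] and [w e_k = w], [f (u e_k - u) = (w
    - f u) - (w - f u) e_k] is small, and [f] is injective and open onto its range. *)
Lemma orbit_span_inj Y1 Y2 (act1 : Y1 -> A -> Y1) (act2 : Y2 -> A -> Y2) f u :
  right_frechet_module mul act1 -> right_frechet_module mul act2 ->
  right_module_map act1 act2 f -> injective f -> closed (range f) ->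
  orbit_span act2 (f u) -> orbit_span act1 u.
Proof.
move=> Y1m Y2m [fl fc fa] fi fcl fu.
have [frY1 [_ act1r] _ _] := Y1m; have [frY2 [_ act2r] _ _] := Y2m.
rewrite /orbit_span ((closure_id (closure _)).1 (@closed_closure _ _)).
apply/closure0P => U U0.
have [V V0 VU] := closed_range_open invn_cvg0 frY1 frY2 fl fc fcl U0.
have [V1 V10 V1V] := nbhs0_sub V0.
have [V2 V20 V2V] := act_unit_small Y2m V10.
have /closure0P /(_ _ (filterI V10 V20)) [w [k0 wk] [Vw1 Vw2]] :=
  orbit_span_dense Y2m fu.
have [k k0k Vk] := V2V k0.
exists (act1 u (e k)); first exact: orbit_span_act.
have [|z Uz zE] := VU (f (act1 u (e k) - u)).
  split; last by exists (act1 u (e k) - u).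
  have := V1V _ _ Vw1 (Vk _ Vw2).
  rewrite (linB (act2r _)) wk // -fa opprB addrC subrKA.
  by rewrite (linB fl).
by rewrite -(fi _ _ zE).
Qed.

(** A preimage of [z] under [g] need not lie in the closed span of [Y2 A]. Lifting eventually fixed
    vectors shows that [g] is nearly open between the closed spans; it is then open between them,
    hence onto. *)
Lemma orbit_span_surj Y2 Y3 (act2 : Y2 -> A -> Y2) (act3 : Y3 -> A -> Y3) g z :
  right_frechet_module mul act2 -> right_frechet_module mul act3 ->
  right_module_map act2 act3 g -> range g = setT ->
  orbit_span act3 z -> exists2 y, orbit_span act2 y & g y = z.
Proof.
move=> Y2m Y3m gm gs z3; have [gl gc ga] := gm.
have [frY2 [_ act2r] _ _] := Y2m; have [frY3 [_ act3r] _ _] := Y3m.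
have gcl : closed (range g) by rewrite gs; exact: closedT.
have near_open U : nbhs 0 U -> exists2 V, nbhs 0 V &
    V `&` orbit_span act3 `<=` closure (g @` (U `&` orbit_span act2)).
  move=> /(act_unit_small Y2m) [V2 V20 V2U].
  have [V V0 VV2] := closed_range_open invn_cvg0 frY2 frY3 gl gc gcl V20.
  have [V1 [V10 _ V1V]] := nbhs0_half V0.
  exists V1 => // w [V1w w3]; apply/closure0P => Q Q0.
  have /closure0P /(_ _ (filterI V10 Q0)) [w' [k0 wk] [Vw Qw]] := orbit_span_dense Y3m w3.
  have [|y V2y yE] := VV2 w'.
    by split; [rewrite -[w'](subrK w) addrC; exact: V1V|rewrite gs].
  have [k k0k Uk] := V2U k0.
  (* [w'] is fixed by [e k], so it lifts to [y e_k], which is small because [y] is. *)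
  exists w' => //; exists (act2 y (e k)); last by rewrite ga yE wk.
  by split; [exact: Uk|exact: orbit_span_act].
have [|V V0 VL] := near_open_open frY2 (hausdorff_frechet frY3) gl gc
  (@subspace_closed_span _ _ _) (@closed_closure _ _) (@subspace_closed_span _ _ _)
  (fun x => orbit_span_map gm) near_open (U := setT); first exact: filterT.
(* Openness reaches only vectors of [V], so [z] is scaled into [V] and its preimage scaled back. *)
have [t t0 Vt] := nbhs0_absorb_neq0 z V0.
have [|y [_ y2] yE] := VL (t *: z).
  by split => //; apply: subspaceZ z3; exact: subspace_closed_span.
exists (t^-1 *: y); first by apply: subspaceZ y2; exact: subspace_closed_span.
by rewrite (linZ gl) yE scalerA mulVf // scale1r.
Qed.

Lemma trivial_actE a (c : K^o) : trivial_act mul a c = 0.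
Proof. exact: mul0r. Qed.

(** [T] and [Y] solve the same universal problem. [psi] linearizes scalar multiplication; the
    identity and [t => tau (psi t) 1] both linearize [tau], so they agree. *)
Lemma tensor_scalars_iso Y (T : tvsType K) (tau : Y -> K^o -> T) :
  is_frechet Y -> is_projective_tensor tau ->
  exists psi : T -> Y, [/\ linear psi, continuous psi,
    forall y c, psi (tau y c) = c *: y & forall t, tau (psi t) 1 = t].
Proof.
move=> frY [frT [taul taur] tauc tauU].
have [_ sb sc _] := is_projective_tensor_scalars frY.
have [psi [[psil psic psiE] _]] := tauU _ _ frY sb sc.
exists psi; split => // t.
have [f0 [_ fU]] := tauU _ tau frT (conj taul taur) tauc.
have idE : f0 = id by apply: fU; split => // y; exact: cvg_id.
suff : f0 = (fun t => tau (psi t) 1) by rewrite idE => /(congr1 (fun f => f t)).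
apply: fU; split.
- by move=> k x y; rewrite psil; exact: taur.
- move=> x; apply: (@continuous_comp T Y T psi (tau^~ 1)); first exact: psic.
  apply: (@continuous_comp Y (Y * K^o)%type T (fun y => (y, 1)) (fun z => tau z.1 z.2)).
    by apply: (cvg_pair (G := nbhs (psi x)) (H := nbhs (1 : K^o))); [exact: cvg_id|exact: cvg_cst].
  exact: tauc.
- move=> y c; rewrite psiE (linZ (taur _)) -(linZ (taul _)); congr (tau _ _).
  exact: mulr1.
Qed.

(** [A] acts by zero on the scalars, so the generators reduce to [tau (y a) c], which [psi] sends to
    [c (y a)]. *)
Lemma balanced_kernel_trivial Y (act : Y -> A -> Y) (T : tvsType K)
    (tau : Y -> K^o -> T) (psi : T -> Y) :
  is_projective_tensor tau ->
  linear psi -> continuous psi -> (forall y c, psi (tau y c) = c *: y) ->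
  (forall t, tau (psi t) 1 = t) ->
  forall t, balanced_kernel act (trivial_act mul) tau t <-> orbit_span act (psi t).
Proof.
move=> [frT [taul taur] tauc _] psil psic psiE tauK t.
split; last first.
  rewrite -{2}[t]tauK; apply: (closed_span_map (f := tau^~ 1)).
  - exact: taur.
  - move=> x; apply: (@continuous_comp Y (Y * K^o)%type T (fun y => (y, 1)) (fun z => tau z.1 z.2)).
      by apply: (cvg_pair (G := nbhs x) (H := nbhs (1 : K^o))); [exact: cvg_id|exact: cvg_cst].
    exact: tauc.
  - exact: subspace_closed_span.
  - exact: closed_closure.
  - move=> _ [y [a ->]]; apply: closed_span_sub; exists y, a, 1.
    by rewrite trivial_actE (lin0 (taul _)) subr0.
move=> tB; apply: (closed_span_map psil psic (W := orbit_span act) _ _ _ tB).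
- exact: subspace_closed_span.
- exact: closed_closure.
- move=> _ [y [a [c ->]]]; rewrite trivial_actE (lin0 (taul _)) subr0 psiE.
  apply: (@subspaceZ _ _ (orbit_span act)); last exact: orbit_span_act.
  exact: subspace_closed_span.
Qed.

(** Transported along the maps [psi], injectivity is [orbit_span_inj], exactness in the middle
    follows from [orbit_span_surj], and surjectivity is that of [g]. *)
Lemma strictly_flat_trivial : is_frechet (K^o : tvsType K) ->
  strictly_flat mul (trivial_act mul).
Proof.
move=> frK; split.
  split => //.
  - split=> [a k x y|c k a b]; rewrite !trivial_actE.
      by rewrite scaler0 addr0.
    by rewrite scaler0 addr0.
  - by move=> a b x; rewrite !trivial_actE.
  - rewrite /jointly_continuous.
    under [X in continuous X]funext do rewrite trivial_actE.
    by move=> z; exact: cvg_cst.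
move=> Y1 Y2 Y3 act1 act2 act3 f g Y1m Y2m Y3m fm gm [fi fg gs] T1 T2 T3
  tau1 tau2 tau3 F G tau1P tau2P tau3P Fl Fc FE Gl Gc GE.
have [frY1 _ _ _] := Y1m; have [frY2 _ _ _] := Y2m; have [frY3 _ _ _] := Y3m.
have [psi1 [l1 c1 E1 K1]] := tensor_scalars_iso frY1 tau1P.
have [psi2 [l2 c2 E2 K2]] := tensor_scalars_iso frY2 tau2P.
have [psi3 [l3 c3 E3 K3]] := tensor_scalars_iso frY3 tau3P.
have B1 := balanced_kernel_trivial act1 tau1P l1 c1 E1 K1.
have B2 := balanced_kernel_trivial act2 tau2P l2 c2 E2 K2.
have B3 := balanced_kernel_trivial act3 tau3P l3 c3 E3 K3.
have psiF u : psi2 (F u) = f (psi1 u) by rewrite -{1}[u]K1 FE E2 scale1r.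
have psiG v : psi3 (G v) = g (psi2 v) by rewrite -{1}[v]K2 GE E3 scale1r.
(* The range of [f] is the kernel of [g], so the open mapping theorem applies to [f]. *)
have fcl : closed (range f).
  rewrite fg; have -> : [set v | g v = 0] = g @^-1` [set 0] by [].
  apply: closed_comp; first by case: gm => _ gc _ x _; exact: gc.
  by apply: accessible_closed_set1; apply: hausdorff_accessible; case: frY3.
have [gl _ _] := gm.
split.
- move=> u; split=> [/B2|/B1 u1].
    by rewrite psiF => /(orbit_span_inj Y1m Y2m fm fi fcl) /B1.
  by apply/B2; rewrite psiF; exact: orbit_span_map fm _.
- move=> v; split=> [/B3|[u /B2]].
    (* [y] lies in the closed span and has the same image as [psi2 v], so their difference is in the
       kernel of [g], the range of [f]. *)
    rewrite psiG => /(orbit_span_surj Y2m Y3m gm gs) [y y2 yE].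
    have [u _ uE] : range f (psi2 v - y).
      by rewrite fg /= (linB gl) yE subrr.
    exists (tau1 u 1); apply/B2.
    by rewrite (linB l2) psiF E1 scale1r uE opprB addrC subrK.
  rewrite (linB l2) psiF => /(orbit_span_map gm); rewrite (linB gl).
  have -> : g (f (psi1 u)) = 0.
    have : range f (f (psi1 u)) by exists (psi1 u).
    by rewrite fg.
  by rewrite subr0 -psiG => /B3.
- move=> w; have [y _ yE] : range g (psi3 w) by rewrite gs.
  exists (tau2 y 1); apply/B3; rewrite (linB l3) psiG E2 scale1r yE subrr.
  by have [] := @subspace_closed_span _ _ [set t | exists y a, t = act3 y a].
Qed.

End Flatness.
(** * Topology of a sequence of seminorms *)

Definition seminorm_sequence (K : numFieldType) (E : lmodType K) (p : nat -> E -> K) :=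
  [/\ forall n x, 0 <= p n x, forall n x y, p n (x + y) <= p n x + p n y,
      forall n k x, p n (k *: x) = `|k| * p n x & forall n x, p n x <= p n.+1 x].

(** A copy of [E] indexed by the proof [hp], so that instances can attach to it the topology defined
    by [p]. *)
Definition seminormed (K : numFieldType) (E : lmodType K) (p : nat -> E -> K)
  (hp : seminorm_sequence p) : Type := E.

Section Seminormed.
Context {K : numFieldType} {E : lmodType K} {p : nat -> E -> K}.
Variable hp : seminorm_sequence p.
Local Notation T := (seminormed hp).

HB.instance Definition _ := GRing.Lmodule.on T.

Lemma snorm_ge0 n (x : T) : 0 <= p n x. Proof. by case: hp. Qed.
Lemma snormD n (x y : T) : p n (x + y) <= p n x + p n y. Proof. by case: hp. Qed.
Lemma snormZ n k (x : T) : p n (k *: x) = `|k| * p n x. Proof. by case: hp. Qed.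

Lemma snorm0 n : p n (0 : T) = 0.
Proof. by rewrite -(scale0r 0) snormZ normr0 mul0r. Qed.

Lemma snormN n (x : T) : p n (- x) = p n x.
Proof. by rewrite -scaleN1r snormZ normrN1 mul1r. Qed.

Lemma snormB n (x y : T) : p n (x - y) = p n (y - x).
Proof. by rewrite -snormN opprB. Qed.

Lemma snorm_le m n (x : T) : (m <= n)%N -> p m x <= p n x.
Proof.
elim: n => [|n IHn]; first by rewrite leqn0 => /eqP ->.
rewrite leq_eqVlt => /orP [/eqP -> //|/IHn]; move/le_trans; apply.
by case: hp.
Qed.

(** A single seminorm suffices for a basic neighbourhood because the sequence is increasing. *)
Definition snorm_nbhs (x : T) : set_system T :=
  [set U | exists n r, 0 < r /\ forall y : T, p n (y - x) < r -> U y].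

HB.instance Definition _ := hasNbhs.Build T snorm_nbhs.

Lemma snorm_nbhs_filter (x : T) : ProperFilter (nbhs x).
Proof.
apply: Build_ProperFilter_ex => [U [n [r [r0 rU]]]|].
  by exists x; apply: rU; rewrite subrr snorm0.
split.
- by exists 0%N, 1; split.
- move=> U V [n [r [r0 rU]]] [m [s [s0 sV]]].
  (* [K] is only partially ordered, but positive elements are real, hence comparable. *)
  have rs : r >=< s by apply: real_comparable; exact: gtr0_real.
  exists (maxn n m), (Num.min r s); split; first by rewrite comparable_lt_min // r0.
  move=> y; rewrite comparable_lt_min // => /andP[yr ys]; split.
    by apply: rU; apply: le_lt_trans yr; apply: snorm_le; exact: leq_maxl.
  by apply: sV; apply: le_lt_trans ys; apply: snorm_le; exact: leq_maxr.
- by move=> U V UV [n [r [r0 rU]]]; exists n, r; split => // y /rU /UV.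
Qed.

Lemma snorm_nbhs_singleton (x : T) (U : set T) : nbhs x U -> U x.
Proof. by move=> [n [r [r0 rU]]]; apply: rU; rewrite subrr snorm0. Qed.

Lemma snorm_nbhs_ball n r (x y : T) :
  p n (y - x) < r -> nbhs y [set z : T | p n (z - x) < r].
Proof.
move=> yr; exists n, (r - p n (y - x)); split; first by rewrite subr_gt0.
move=> z zy /=; rewrite -[z - x](subrKA y).
by apply: le_lt_trans (snormD _ _ _) _; rewrite -ltrBrDr.
Qed.

Lemma snorm_nbhs_nbhs (x : T) (U : set T) : nbhs x U -> nbhs x (nbhs^~ U).
Proof.
move=> [n [r [r0 rU]]]; exists n, r; split => // y yr.
have [m [s [s0 sB]]] := snorm_nbhs_ball yr.
by exists m, s; split => // z /sB /rU.
Qed.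

HB.instance Definition _ := Nbhs_isNbhsTopological.Build T
  snorm_nbhs_filter snorm_nbhs_singleton snorm_nbhs_nbhs.

Lemma snorm_ball n r (x : T) : 0 < r -> nbhs x [set y : T | p n (y - x) < r].
Proof. by move=> r0; exists n, r; split. Qed.

Lemma snorm_add_continuous : continuous (fun x : T * T => x.1 + x.2).
Proof.
move=> [x y] U [n [r [r0 rU]]].
exists ([set z | p n (z - x) < r / 2], [set z | p n (z - y) < r / 2]).
  by split; apply: snorm_ball; rewrite divr_gt0.
move=> [z w] /= [zr wr]; apply: rU => /=; rewrite opprD addrACA.
by apply: le_lt_trans (snormD _ _ _) _; rewrite [r]splitr ltrD.
Qed.

Lemma snorm_scale_continuous : continuous (fun z : K^o * T => z.1 *: z.2).
Proof.
move=> [k x] U [n [r [r0 rU]]].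
(* From [l y - k x = l (y - x) + (l - k) x]: the bound 1 gives [|l| <= |k| + 1], and the quotient is
   [r] shared out over [|k| + 1] and [p n x]. *)
pose d := Num.min 1 (r / (p n x + `|k| + 1)).
have c0 : 0 < p n x + `|k| + 1 by rewrite ltr_wpDl // addr_ge0 // snorm_ge0.
have q0 : 0 < r / (p n x + `|k| + 1) by rewrite divr_gt0.
have cmp : 1 >=< r / (p n x + `|k| + 1) by apply: real_comparable; [exact: real1|exact: gtr0_real].
have d0 : 0 < d by rewrite comparable_lt_min // ltr01.
exists ([set l | `|k - l| < d], [set z | p n (z - x) < d]).
  by split; [exact: (nbhsx_ballx (k : K^o) d d0)|exact: snorm_ball].
move=> [l y] /= [lk yx]; apply: rU => /=.
rewrite comparable_lt_min // in lk; have /andP[lk1 lk2] := lk.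
rewrite comparable_lt_min // in yx; have /andP[yx1 yx2] := yx.
have -> : l *: y - k *: x = l *: (y - x) + (l - k) *: x.
  by rewrite scalerBr scalerBl subrKA.
apply: le_lt_trans (snormD _ _ _) _; rewrite !snormZ.
have lk' : `|l| <= `|k| + 1.
  rewrite -[l](subrK k) addrC; apply: le_trans (ler_normD _ _) _.
  by rewrite lerD2l distrC ltW.
have -> : r = (`|k| + 1) * (r / (p n x + `|k| + 1)) +
    (r / (p n x + `|k| + 1)) * p n x.
  by rewrite [X in _ + X]mulrC -mulrDl addrC addrA mulrC divfK // gt_eqF.
apply: ltr_leD.
  apply: le_lt_trans (ler_wpM2r (snorm_ge0 _ _) lk') _.
  by rewrite ltr_pM2l // ltr_wpDl.
by rewrite ler_wpM2r ?snorm_ge0 // distrC ltW.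
Qed.

Local Open Scope convex_scope.

Lemma snorm_ball_convex n r (x : T) :
  convex_set ([set y | p n (y - x) < r] : set (convex_lmodType T)).
Proof.
apply/convex_setW => y z; rewrite !inE /= => yr zr l l0 l1; rewrite inE /=.
rewrite [X in p n X](_ : _ = l%:num *: (y - x) + (1 - l%:num) *: (z - x)); last first.
  rewrite !scalerBr addrACA -opprD; congr (_ - _).
  by rewrite -scalerDl addrC subrK scale1r.
apply: le_lt_trans (snormD _ _ _) _; rewrite !snormZ.
rewrite (@ger0_norm _ l%:num) // (@ger0_norm _ (1 - l%:num)); last first.
  by rewrite subr_ge0 ltW.
rewrite -[r]mul1r -[X in X * r](subrK l%:num) addrC [ltRHS]mulrDl.
by rewrite addrC [ltRHS]addrC ltrD // ltr_pM2l // subr_gt0.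
Qed.

Local Close Scope convex_scope.

Lemma snorm_locally_convex : exists2 B : set_system T,
  (forall b, b \in B -> convex_set (b : set (convex_lmodType T))) & basis B.
Proof.
exists [set B | exists n r (x : T), B = [set y : T | p n (y - x) < r]].
  by move=> B /=; rewrite inE => -[n [r [x ->]]]; exact: snorm_ball_convex.
split.
  by move=> _ [n [r [x ->]]]; rewrite openE => y; exact: snorm_nbhs_ball.
move=> x U [n [r [r0 rU]]]; exists [set y : T | p n (y - x) < r] => //.
by split; [exists n, r, x|rewrite /= subrr snorm0].
Qed.

HB.instance Definition _ := PreTopologicalLmod_isTvs.Build K T
  snorm_add_continuous snorm_scale_continuous snorm_locally_convex.
HB.instance Definition _ :=
  PreTopologicalNmodule_isTopologicalNmodule.Build T snorm_add_continuous.
HB.instance Definition _ :=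
  TopologicalNmodule_isTopologicalLmodule.Build K T snorm_scale_continuous.
HB.instance Definition _ := Uniform_isTvs.Build K T snorm_locally_convex.

Local Notation T' := (T : tvsType K).

Lemma nbhs0_snormP (U : set T') : nbhs 0 U <->
  exists n r, 0 < r /\ forall y : T, p n y < r -> U y.
Proof.
split=> [[n [r [r0 rU]]]|[n [r [r0 rU]]]]; exists n, r; split => // y yr.
  by apply: rU; rewrite subr0.
by apply: rU; rewrite subr0 in yr.
Qed.

Lemma nbhs0_snorm_ball n r : 0 < r -> nbhs (0 : T) [set y : T | p n y < r].
Proof. by move=> r0; apply/nbhs0_snormP; exists n, r. Qed.

Lemma snorm_bounded (B : set T') n : tvs_bounded B -> exists C, forall x, B x -> p n x <= C.
Proof.
move=> /(_ _ (nbhs0_snorm_ball n ltr01)) [t tB]; exists `|t| => x /tB [y /= y1 <-].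
by rewrite snormZ ler_piMr // ltW.
Qed.

Lemma snorm_topology_given_by : topology_given_by (range p : set (T' -> K)).
Proof.
move=> U; split=> [/nbhs0_snormP [n [r [r0 rU]]]|[S [r [Sf SP r0 SU]]]].
  exists [set p n], r; split => //; first by move=> _ ->; exists n.
  by move=> x /(_ _ erefl) /rU.
apply: filterS SU _; have [D DS] := finite_fsetP.1 Sf.
have Dball q : q \in D -> nbhs (0 : T') [set x | q x < r].
  move=> qD; have /SP [n _ <-] : S q by rewrite DS.
  exact: nbhs0_snorm_ball.
have := @filter_bigI _ _ D (fun q => [set x : T' | q x < r]) _ (nbhs_filter 0) Dball.
by apply: filterS => x xD q; rewrite DS => /xD.
Qed.

Lemma snorm_hausdorff : (forall x : T, (forall n, p n x = 0) -> x = 0) ->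
  hausdorff_space T'.
Proof.
move=> sep x y xy; apply/eqP; rewrite -subr_eq0; apply/eqP; apply: sep => n.
have := snorm_ge0 n (x - y); rewrite le_eqVlt => /orP [/eqP <- //|a0].
have r0 : 0 < p n (x - y) / 2 by rewrite divr_gt0.
have [z [/= zx zy]] := xy _ _ (snorm_ball n x r0) (snorm_ball n y r0).
have := snormD n (x - z) (z - y); rewrite subrKA => /le_lt_trans.
rewrite snormB => /(_ _ (ltrD zx zy)).
by rewrite -splitr ltxx.
Qed.

Lemma snorm_frechet : (fun n => n.+1%:R^-1 : K^o) @ \oo --> (0 : K^o) ->
  (forall x : T, (forall n, p n x = 0) -> x = 0) -> lmod_complete T' -> is_frechet T'.
Proof.
move=> invn sep cT; split => //; first exact: snorm_hausdorff.
exists (fun n => [set x : T' | p n x < n.+1%:R^-1]); split=> [n|V].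
  by apply: nbhs0_snorm_ball; rewrite invr_gt0 ltr0Sn.
move=> /nbhs0_snormP [n [r [r0 rV]]].
have [m _ mr] := invn _ (nbhsx_ballx (0 : K^o) r r0).
exists (maxn n m) => x /= xm; apply: rV; apply: le_lt_trans (snorm_le _ (leq_maxl n m)) _.
apply: lt_trans xm _; have /= := mr (maxn n m) (leq_maxr n m).
by rewrite -ball_normE /= sub0r normrN gtr0_norm // invr_gt0 ltr0Sn.
Qed.

Section Algebra.
Context (mul : T' -> T' -> T').
Hypothesis mul_bilinear : bilinear_map mul.
Hypothesis mul_snorm : forall n x y, p n (mul x y) <= p n x * p n y.

Lemma snorm_mul_continuous : jointly_continuous mul.
Proof.
have [mull mulr] := mul_bilinear.
move=> [x y] U [n [r [r0 rU]]].
pose c := p n y + p n x + 1.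
have c0 : 0 < c by rewrite ltr_wpDl // addr_ge0 // snorm_ge0.
have cmp : 1 >=< r / c.
  by apply: real_comparable; [exact: real1|apply: gtr0_real; rewrite divr_gt0].
have d0 : 0 < Num.min 1 (r / c) by rewrite comparable_lt_min // ltr01 divr_gt0.
exists ([set z | p n (z - x) < Num.min 1 (r / c)], [set z | p n (z - y) < Num.min 1 (r / c)]).
  by split; exact: snorm_ball.
move=> [z w] /= [zx wy]; apply: rU => /=.
rewrite comparable_lt_min // in zx; have /andP[zx1 zx2] := zx.
rewrite comparable_lt_min // in wy; have /andP[wy1 wy2] := wy.
rewrite -[mul z w - _](subrKA (mul z y)) -(linB (mull z)) -(linB (mulr y)).
apply: le_lt_trans (snormD _ _ _) _.
apply: le_lt_trans (lerD (mul_snorm _ _ _) (mul_snorm _ _ _)) _.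
have z_le : p n z <= p n x + 1.
  rewrite -[z](subrK x) addrC; apply: le_trans (snormD _ _ _) _.
  by rewrite lerD2l ltW.
have -> : r = (p n x + 1) * (r / c) + (r / c) * p n y.
  by rewrite [X in _ + X]mulrC -mulrDl addrC addrA mulrC divfK // gt_eqF.
apply: ltr_leD.
  apply: le_lt_trans (ler_wpM2r (snorm_ge0 _ _) z_le) _.
  by rewrite ltr_pM2l // ltr_wpDl // snorm_ge0.
by rewrite ler_wpM2r ?snorm_ge0 // ltW.
Qed.

End Algebra.

End Seminormed.

(** * Modulus and limits in the complex numbers *)

Section ComplexScalars.
Context {R : realType}.
Local Notation nm := (@Normc.normc R).
Implicit Types x y z : R[i].

(** The norm of [R[i]] takes values in [R[i]]. Estimates are made with the real-valued modulus [nm],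
    and this equation converts between the two. *)
Lemma normr_normc x : `|x| = (nm x)%:C%C. Proof. by []. Qed.

Lemma normc_ge0 x : 0 <= nm x.
Proof. by rewrite -ler0c -normr_normc. Qed.

Lemma normcB x y : nm (x - y) = nm (y - x).
Proof. by apply: (@complexI R); rewrite -!normr_normc distrC. Qed.

Lemma normc_triangle x y z : nm (x - z) <= nm (x - y) + nm (y - z).
Proof. by rewrite -[x - z](subrKA y); exact: le_normcD. Qed.

Lemma normc_sub_le x y : nm (x - y) <= nm x + nm y.
Proof. by rewrite -(normcN y); exact: le_normcD. Qed.

Lemma normc_le_add x y : nm x <= nm y + nm (x - y).
Proof. by rewrite -{1}[x](subrK y) addrC; exact: le_normcD. Qed.

Lemma normr_Re_le x : `|complex.Re x| <= nm x.
Proof. by case: x => a b /=; rewrite -sqrtr_sqr ler_wsqrtr // lerDl sqr_ge0. Qed.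

Lemma normr_Im_le x : `|complex.Im x| <= nm x.
Proof. by case: x => a b /=; rewrite -sqrtr_sqr ler_wsqrtr // lerDr sqr_ge0. Qed.

Lemma normc_le_Re_Im x : nm x <= `|complex.Re x| + `|complex.Im x|.
Proof.
case: x => a b /=; rewrite -[leRHS]ger0_norm ?addr_ge0 // -sqrtr_sqr ler_wsqrtr //.
rewrite sqrrD !real_normK ?num_real // -addrA lerD2l lerDr.
by rewrite mulrn_wge0 // mulr_ge0.
Qed.

Section Limits.
Context {T : Type} (F : set_system T) {FF : ProperFilter F} (f : T -> R[i]).

Lemma complex_limit (a b : R) :
  (forall e : R, 0 < e -> F [set t | `|complex.Re (f t) - a| < e]) ->
  (forall e : R, 0 < e -> F [set t | `|complex.Im (f t) - b| < e]) ->
  forall e : R, 0 < e -> F [set t | nm (f t - (a +i* b)%C) < e].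
Proof.
move=> Fa Fb e e0; have e2 : 0 < e / 2 by rewrite divr_gt0.
apply: filterS (filterI (Fa _ e2) (Fb _ e2)) => t [/= ta tb].
apply: le_lt_trans (normc_le_Re_Im _) _; rewrite [e]splitr.
by case: (f t) ta tb => c d /= ta tb; exact: ltrD.
Qed.

Lemma real_cauchy_limit (g : T -> R) :
  (forall e : R, 0 < e -> exists2 B, F B & forall s t, B s -> B t -> `|g s - g t| < e) ->
  exists a, forall e : R, 0 < e -> F [set t | `|g t - a| < e].
Proof.
move=> gF; have gc : cauchy (g @ F).
  apply: cauchy_exP => e e0; have [B FB Be] := gF _ e0.
  have [b Bb] := filter_ex FB; exists (g b).
  suff : F [set t | ball (g b) e (g t)] by [].
  by apply: filterS FB => t Bt; rewrite /= -ball_normE /=; exact: Be.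
have [a ga] : exists a : R, g @ F --> a by apply/cvg_ex; exact: (cauchy_cvg (g @ F) gc).
exists a => e e0; have : F [set t | ball a e (g t)] := ga _ (nbhsx_ballx a e e0).
by apply: filterS => t; rewrite /= -ball_normE /= distrC.
Qed.

Lemma complex_cauchy_limit :
  (forall e : R, 0 < e -> exists2 B, F B & forall s t, B s -> B t -> nm (f s - f t) < e) ->
  exists l, forall e : R, 0 < e -> F [set t | nm (f t - l) < e].
Proof.
move=> fF.
have [a Fa] : exists a, forall e : R, 0 < e -> F [set t | `|complex.Re (f t) - a| < e].
  apply: real_cauchy_limit => e /fF [B FB Be]; exists B => // s t Bs Bt.
  apply: le_lt_trans (Be s t Bs Bt); apply: le_trans (normr_Re_le _).
  by case: (f s) => a b; case: (f t).
have [b Fb] : exists b, forall e : R, 0 < e -> F [set t | `|complex.Im (f t) - b| < e].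
  apply: real_cauchy_limit => e /fF [B FB Be]; exists B => // s t Bs Bt.
  apply: le_lt_trans (Be s t Bs Bt); apply: le_trans (normr_Im_le _).
  by case: (f s) => c d; case: (f t).
by exists (a +i* b)%C; exact: complex_limit.
Qed.

(** Compactness of a segment gives a cluster point, and along an ultrafilter a cluster point is a
    limit. *)
Lemma real_ultra_limit (g : T -> R) (C : R) : UltraFilter F ->
  F [set t | `|g t| <= C] -> exists a, forall e : R, 0 < e -> F [set t | `|g t - a| < e].
Proof.
move=> FU FC; have [|a [_ ga]] := @segment_compact R (- C) C (g @ F) _.
  suff : F (g @^-1` `[- C, C]%classic) by [].
  by apply: filterS FC => t; rewrite /= in_itv /= ler_norml.
exists a => e e0; have [//|nF] := in_ultra_setVsetC [set t | `|g t - a| < e] FU.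
have gF : (g @ F) [set x | e <= `|x - a|].
  suff : F [set t | e <= `|g t - a|] by [].
  by apply: filterS nF => t /negP; rewrite -leNgt.
have [x [xa]] := ga _ _ gF (nbhsx_ballx a e e0).
by rewrite -ball_normE /= distrC ltNge xa.
Qed.

Lemma complex_ultra_limit (C : R) : UltraFilter F ->
  F [set t | nm (f t) <= C] -> exists l, forall e : R, 0 < e -> F [set t | nm (f t - l) < e].
Proof.
move=> FU FC.
have [|a Fa] := @real_ultra_limit (fun t => complex.Re (f t)) C FU.
  by apply: filterS FC => t; apply: le_trans; exact: normr_Re_le.
have [|b Fb] := @real_ultra_limit (fun t => complex.Im (f t)) C FU.
  by apply: filterS FC => t; apply: le_trans; exact: normr_Im_le.
by exists (a +i* b)%C; exact: complex_limit.
Qed.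

End Limits.

Lemma gt0_complexE (r : R[i]) : 0 < r -> exists2 s : R, 0 < s & r = s%:C%C.
Proof.
move=> r0; have /complex_realP [s rE] : r \is Num.real by exact: gtr0_real.
by exists s => //; rewrite -ltcR -rE.
Qed.

Lemma complex_invn_cvg0 : (fun n => n.+1%:R^-1 : R[i]^o) @ \oo --> (0 : R[i]^o).
Proof.
move=> U /nbhs_ballP [_ /posnumP[r] rU].
have [s s0 rE] := gt0_complexE (gt0 r).
have [m mE] : exists m : nat, s^-1 < m.+1%:R.
  exists (Num.truncn s^-1); exact: truncnS_gt.
exists m => // n /= mn; apply: rU; rewrite -ball_normE /= sub0r normrN rE.
rewrite normfV normr_nat -[n.+1%:R](rmorph_nat (real_complex R)) -fmorphV ltcR.
rewrite invf_plt ?posrE ?ltr0Sn //; apply: lt_le_trans mE _.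
by rewrite ler_nat ltnS.
Qed.

Lemma nbhs0_complexP (U : set R[i]^o) : nbhs 0 U <->
  exists2 s : R, 0 < s & forall x, nm x < s -> U x.
Proof.
split=> [/nbhs_ballP [_ /posnumP[r] rU]|[s s0 sU]].
  have [s s0 rE] := gt0_complexE (gt0 r); exists s => // x xs.
  by apply: rU; rewrite -ball_normE /= sub0r normrN rE normr_normc ltcR.
apply/nbhs_ballP; exists s%:C%C; first by rewrite /= ltcR.
by move=> x; rewrite -ball_normE /= sub0r normrN normr_normc ltcR => /sU.
Qed.

Lemma frechet_complex : is_frechet (R[i]^o : tvsType R[i]).
Proof.
split.
- exact: norm_hausdorff.
- exists (fun n => [set x : R[i]^o | nm x < n.+1%:R^-1]); split=> [n|V].
    by apply/nbhs0_complexP; exists n.+1%:R^-1 => //; rewrite invr_gt0 ltr0Sn.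
  move=> /nbhs0_complexP [s s0 sV]; exists (Num.truncn s^-1) => x /= xs.
  apply: sV; apply: lt_trans xs _; rewrite invf_plt ?posrE ?ltr0Sn //; exact: truncnS_gt.
- move=> F FF Fc; have [|l Fl] := @complex_cauchy_limit _ F FF (fun x => x).
    move=> e e0; have [|B FB Be] := Fc [set x : R[i]^o | nm x < e].
      by apply/nbhs0_complexP; exists e.
    by exists B.
  exists l; apply/(@cvg0P _ (R[i]^o) F _ l) => U /nbhs0_complexP [s s0 sU].
  by apply: filterS (Fl _ s0) => x /sU.
Qed.

End ComplexScalars.
(** * The weighted sequence algebra *)

Section Weights.

(* [logn 2 k.+1] serves as a map from [nat] to [nat] with infinite fibres.    *)
(* The weight [wbase n k ^ n] is bounded on the fibre over [n], where the     *)
(* weights of larger index are not.                                           *)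
Definition wbase (n k : nat) : nat :=
  (logn 2 k.+1).+1 + (if (logn 2 k.+1 < n)%N then k else 0%N).

Lemma wbase_le m n k : (m <= n)%N -> (wbase m k <= wbase n k)%N.
Proof.
move=> mn; rewrite /wbase leq_add2l; case: ifP => // km.
by rewrite (leq_trans km mn).
Qed.

Lemma wbase_expl e m n k : (m <= n)%N -> (wbase m k ^ e <= wbase n k ^ e)%N.
Proof. by case: e => // e mn; rewrite leq_exp2r ?wbase_le. Qed.

Lemma wbase_exp_le m n k : (m <= n)%N -> (wbase m k ^ m <= wbase n k ^ n)%N.
Proof.
by move=> mn; apply: leq_trans (wbase_expl m k mn) _; rewrite leq_pexp2l.
Qed.

(** If [logn 2 k.+1] is at least [M], the extra factor [wbase n.+1 k] exceeds [M]; otherwise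
    [wbase m k] contains the summand [k >= K]. That [m] does not depend on [K] is what makes tails
    uniformly small. *)
Lemma wbase_exp_split n M : exists m, forall K k, (K <= k)%N ->
  (M.+1 * wbase n k ^ n <= wbase n.+1 k ^ n.+1)%N \/
  (K.+1 * wbase n k ^ n <= wbase m k ^ m)%N.
Proof.
exists (maxn M n.+1) => K k Kk.
have [Mk|kM] := leqP M (logn 2 k.+1).
  left; rewrite expnS leq_mul ?wbase_expl //.
  by rewrite /wbase addSn ltnS (leq_trans Mk) ?leq_addr.
right; apply: (@leq_trans (wbase (maxn M n.+1) k ^ n.+1)); last first.
  by rewrite leq_pexp2l // leq_maxr.
rewrite expnS leq_mul ?wbase_expl //; last by rewrite (leq_trans (leqnSn n)) // leq_maxr.
by rewrite /wbase leq_max kM /= addSn ltnS (leq_trans Kk) ?leq_addl.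
Qed.

Lemma wbase_exp_small n k0 : exists2 k, (k0 <= k)%N & (wbase n k ^ n <= n.+1 ^ n)%N.
Proof.
(* The witness is [k.-1]: its successor has 2-adic valuation exactly [n], so its base is [n.+1]. *)
pose k := (2 ^ n * (k0.*2).+1)%N.
have k_gt0 : (0 < k)%N by rewrite muln_gt0 expn_gt0.
exists k.-1.
  rewrite -ltnS prednK //; apply: (@leq_ltn_trans k0.*2); first by rewrite -addnn leq_addr.
  by rewrite /k leq_pmull // expn_gt0.
rewrite /wbase prednK // /k lognM ?expn_gt0 // pfactorK //.
by rewrite logn_coprime ?coprime2n /= ?odd_double // addn0 ltnn addn0.
Qed.

End Weights.

Section WeightedVariation.
Context {R : realType}.
Local Notation nm := (@Normc.normc R).
Implicit Types x y : nat -> R[i]^o.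

Definition wt n k : R := (wbase n k ^ n)%:R.

Lemma wt_ge1 n k : 1 <= wt n k.
Proof. by rewrite ler1n expn_gt0. Qed.

Lemma wt_ge0 n k : 0 <= wt n k. Proof. exact: le_trans ler01 (wt_ge1 n k). Qed.

Lemma wt_le n k : wt n k <= wt n.+1 k.
Proof. by rewrite ler_nat wbase_exp_le. Qed.

Definition wvar n N x : R := \sum_(k < N) wt n k * nm (x k.+1 - x k).

(* Bounding the last term instead of all of them gives an equivalent norm     *)
(* which is submultiplicative, because [qnorm n N] is the norm of a weighted  *)
(* l^1 algebra with the idempotent basis 1_[0,k], k <= N.                     *)
Definition qnorm n N x : R := nm (x N) + wvar n N x.

Lemma wvarS n N x : wvar n N.+1 x = wvar n N x + wt n N * nm (x N.+1 - x N).
Proof. by rewrite /wvar big_ord_recr. Qed.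

Lemma wvar_term_ge0 n k x : 0 <= wt n k * nm (x k.+1 - x k).
Proof. by rewrite mulr_ge0 ?wt_ge0 ?normc_ge0. Qed.

Lemma wvar_ge0 n N x : 0 <= wvar n N x.
Proof. by apply: sumr_ge0 => k _; exact: wvar_term_ge0. Qed.

Lemma qnorm_ge0 n N x : 0 <= qnorm n N x.
Proof. by rewrite addr_ge0 ?normc_ge0 ?wvar_ge0. Qed.

Lemma wvar_le_qnorm n N x : wvar n N x <= qnorm n N x.
Proof. by rewrite lerDr normc_ge0. Qed.

Lemma normc_le_qnorm n N x : nm (x N) <= qnorm n N x.
Proof. by rewrite lerDl wvar_ge0. Qed.

Lemma wvarD n N x y : wvar n N (x + y) <= wvar n N x + wvar n N y.
Proof.
rewrite -big_split /=; apply: ler_sum => k _; rewrite -mulrDr ler_wpM2l ?wt_ge0 //.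
by rewrite opprD addrACA; exact: le_normcD.
Qed.

Lemma qnormD n N x y : qnorm n N (x + y) <= qnorm n N x + qnorm n N y.
Proof. by rewrite /qnorm addrACA lerD ?wvarD //; exact: le_normcD. Qed.

Lemma qnormZ n N (c : R[i]) x : qnorm n N (c *: x) = nm c * qnorm n N x.
Proof.
rewrite /qnorm mulrDr; congr (_ + _); first exact: Normc.normcM.
rewrite /wvar mulr_sumr; apply: eq_bigr => k _.
rewrite [RHS]mulrCA; congr (_ * _).
by rewrite -Normc.normcM mulrBr.
Qed.

Lemma qnorm_le n N x : qnorm n N x <= qnorm n.+1 N x.
Proof.
by rewrite lerD2l; apply: ler_sum => k _; rewrite ler_wpM2r ?normc_ge0 ?wt_le.
Qed.

Lemma wvar_incr n M N x : (M <= N)%N -> nm (x N - x M) <= wvar n N x - wvar n M x.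
Proof.
elim: N => [|N IHN]; first by rewrite leqn0 => /eqP ->; rewrite !subrr Normc.normc0.
rewrite leq_eqVlt => /orP [/eqP ->|]; first by rewrite !subrr Normc.normc0.
rewrite ltnS => /IHN xMN; apply: le_trans (normc_triangle _ (x N) _) _.
rewrite wvarS addrAC addrC lerD //.
by rewrite ler_peMl ?normc_ge0 ?wt_ge1.
Qed.

(** Whatever the last term loses between [M] and [N] is paid for by the variation there, all weights
    being at least 1. *)
Lemma qnorm_mono n M N x : (M <= N)%N -> qnorm n M x <= qnorm n N x.
Proof.
move=> /(wvar_incr n x) MN; rewrite /qnorm.
have := normc_le_add (x M) (x N); rewrite normcB; lra.
Qed.

(** Induction on [N] with the product rule for increments. *)
Lemma qnorm_mul n N x y :
  qnorm n N (fun k => x k * y k) <= qnorm n N x * qnorm n N y.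
Proof.
elim: N => [|N IHN].
  by rewrite /qnorm /wvar !big_ord0 !addr0 Normc.normcM.
move: IHN; rewrite /qnorm !wvarS.
set X := wvar n N x; set Y := wvar n N y; set Z := wvar n N _.
have X0 : 0 <= X := wvar_ge0 n N x; have Y0 : 0 <= Y := wvar_ge0 n N y.
have w1 := wt_ge1 n N.
set d := nm (x N.+1 - x N); set e := nm (y N.+1 - y N).
set a := nm (x N); set b := nm (y N); set a' := nm (x N.+1); set b' := nm (y N.+1).
have d0 : 0 <= d := normc_ge0 _; have e0 : 0 <= e := normc_ge0 _.
have ad : a <= a' + d by rewrite /a /d normcB; exact: normc_le_add.
have be : b <= b' + e by rewrite /b /e normcB; exact: normc_le_add.
have -> : nm (x N * y N) = a * b := Normc.normcM _ _.
have -> : nm (x N.+1 * y N.+1) = a' * b' := Normc.normcM _ _.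
have dxy : nm (x N.+1 * y N.+1 - x N * y N) <= a' * e + d * b.
  rewrite -Normc.normcM -Normc.normcM.
  have -> : x N.+1 * y N.+1 - x N * y N =
      x N.+1 * (y N.+1 - y N) + (x N.+1 - x N) * y N.
    by rewrite mulrBr mulrBl subrKA.
  exact: le_normcD.
set w := wt n N in w1 *; set D := nm (_ - _) in dxy *.
have a'0 : 0 <= a' := normc_ge0 _; have b'0 : 0 <= b' := normc_ge0 _.
move=> IHN.
have wD : w * D <= w * (a' * e + d * b) by rewrite ler_pM2l; lra.
have wd : d <= w * d by rewrite ler_peMl.
have we : e <= w * e by rewrite ler_peMl.
(* As [w >= 1], the old last terms satisfy [a <= a' + w d] and [b <= b' + w e]; this turns the
   induction hypothesis into a bound by the new norms. *)
have h1 : a * Y <= (a' + w * d) * Y by rewrite ler_wpM2r //; lra.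
have h2 : X * b <= X * (b' + w * e) by rewrite ler_wpM2l //; lra.
have h3 : w * d * b <= w * d * (b' + w * e).
  by rewrite ler_wpM2l ?mulr_ge0 //; lra.
have -> : (a' + (X + w * d)) * (b' + (Y + w * e)) =
  a' * b' + (a' + w * d) * Y + X * (b' + w * e) + X * Y + w * (a' * e)
  + w * d * (b' + w * e) by ring.
have IH' : Z <= a * Y + X * b + X * Y.
  by move: IHN; rewrite mulrDl !mulrDr; lra.
rewrite mulrDr in wD; rewrite -mulrA in h3 *; lra.
Qed.

End WeightedVariation.

(** * Uniformly small tails and coordinatewise limits *)

Section Tails.
Context {R : realType}.
Local Notation nm := (@Normc.normc R).
Implicit Types x y z : nat -> R[i]^o.

(** Each weight past [K] is at most a fraction of the weight of index [n.+1] or of index [m]; adding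
    both fractions avoids sorting the terms. *)
Lemma wvar_tail_split n M : exists m, forall K N z, (K <= N)%N ->
  wvar n N z - wvar n K z <= wvar n.+1 N z / M.+1%:R + wvar m N z / K.+1%:R.
Proof.
have [m mP] := wbase_exp_split n M; exists m => K N z.
elim: N => [|N IHN]; first by rewrite leqn0 => /eqP ->; rewrite subrr addr_ge0 // divr_ge0 ?wvar_ge0.
rewrite leq_eqVlt => /orP [/eqP <-|]; first by rewrite subrr addr_ge0 // divr_ge0 ?wvar_ge0.
rewrite ltnS => KN; have := IHN KN; rewrite !wvarS.
move: (nm _) (normc_ge0 (z N.+1 - z N)) => d d0.
suff : @wt R n N * d <= @wt R n.+1 N * d / M.+1%:R + @wt R m N * d / K.+1%:R.
  by rewrite !mulrDl addrAC addrACA => h1 h2; exact: lerD.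
have t1 : 0 <= @wt R n.+1 N * d / M.+1%:R by rewrite divr_ge0 ?mulr_ge0 ?wt_ge0.
have t2 : 0 <= @wt R m N * d / K.+1%:R by rewrite divr_ge0 ?mulr_ge0 ?wt_ge0.
have bound (L j : nat) : (L.+1 * wbase n N ^ n <= wbase j N ^ j)%N ->
    @wt R n N * d <= @wt R j N * d / L.+1%:R.
  move=> Lj; rewrite ler_pdivlMr ?ltr0Sn // mulrAC ler_wpM2r //.
  by rewrite mulrC -natrM ler_nat.
by case: (mP K N KN) => /bound h; apply: le_trans h _; rewrite ?lerDl // lerDr.
Qed.

(** The order of choices matters: [M] comes from [C n.+1] and brings the first fraction below
    [e / 2]; it fixes [m], and then [K0] from [C m] handles the second. *)
Lemma uniform_tail (C : nat -> R) n e : 0 < e -> exists K0, forall K N z,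
  (K0 <= K)%N -> (K <= N)%N -> (forall m N', qnorm m N' z <= C m) ->
  wvar n N z <= wvar n K z + e.
Proof.
move=> e0; pose t c := Num.truncn (c / (e / 2)).
have e2 : 0 < e / 2 by rewrite divr_gt0.
have tP c k : (t c <= k)%N -> c / k.+1%:R <= e / 2.
  move=> ck; rewrite ler_pdivrMr ?ltr0Sn // mulrC -ler_pdivrMr //.
  apply: le_trans (ltW (truncnS_gt _)) _; by rewrite ler_nat ltnS.
have [m mP] := wvar_tail_split n (t (C n.+1)).
exists (t (C m)) => K N z K0K KN zC.
have h1 : wvar n.+1 N z / (t (C n.+1)).+1%:R <= e / 2.
  apply: le_trans (tP (C n.+1) _ (leqnn _)); rewrite ler_pM2r ?invr_gt0 ?ltr0Sn //.
  exact: le_trans (wvar_le_qnorm _ _ _) (zC _ _).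
have h2 : wvar m N z / K.+1%:R <= e / 2.
  apply: le_trans (tP (C m) _ K0K); rewrite ler_pM2r ?invr_gt0 ?ltr0Sn //.
  exact: le_trans (wvar_le_qnorm _ _ _) (zC _ _).
by rewrite -lerBlDl; apply: le_trans (mP K N z KN) _; rewrite [e]splitr lerD.
Qed.

(** The excess [e] counts once for the variation and once for the last term, whose growth that
    variation bounds. *)
Lemma qnorm_tail n K N z e : 0 <= e -> ((K <= N)%N -> wvar n N z <= wvar n K z + e) ->
  qnorm n N z <= qnorm n K z + e *+ 2.
Proof.
move=> e0 KNe; have [KN|/ltnW NK] := leqP K N; last first.
  by apply: le_trans (qnorm_mono n z NK) _; rewrite lerDl mulrn_wge0.
have := KNe KN; have := wvar_incr n z KN; have := normc_le_add (z N) (z K).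
rewrite /qnorm mulr2n; lra.
Qed.

(** [qnorm n N] involves only the coordinates up to [N], so coordinatewise convergence suffices. *)
Lemma qnorm_limit (T : Type) (F : set_system T) {FF : Filter F}
    (f : T -> nat -> R[i]^o) (l : nat -> R[i]^o) :
  (forall k (e : R), 0 < e -> F [set t | nm (f t k - l k) < e]) ->
  forall n N (e : R), 0 < e -> F [set t | qnorm n N (f t - l) < e].
Proof.
move=> Fl n; elim=> [|N IHN] e e0.
  by apply: filterS (Fl 0%N e e0) => t; rewrite /= /qnorm /wvar big_ord0 addr0.
pose w := @wt R n N; have w1 : 1 <= w := wt_ge1 n N.
(* A quarter of [e] goes to the old norm, a quarter to the new coordinate, and [w (d + d) = e / 2]
   to the new increment. *)
pose d := e / 4 / w.
have d0 : 0 < d by rewrite !divr_gt0 //; lra.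
have e4 : 0 < e / 4 by rewrite divr_gt0.
apply: filterS (filterI (IHN _ e4) (filterI (Fl N d d0) (Fl N.+1 d d0))).
move=> t [/= q4 [tN tS]]; rewrite /qnorm wvarS.
have dw : w * d = e / 4 by rewrite /d mulrC divfK // gt_eqF //; lra.
have wincr : w * nm ((f t - l) N.+1 - (f t - l) N) <= w * (d + d).
  rewrite ler_wpM2l ?wt_ge0 //; apply: le_trans (normc_sub_le _ _) _.
  by rewrite lerD // ltW.
have dle : d <= e / 4 by rewrite -dw ler_peMl // ltW.
have := le_lt_trans (wvar_le_qnorm n N (f t - l)) q4.
move: tS; change (nm ((f t - l) N.+1) < d -> wvar n N (f t - l) < e / 4 ->
  nm ((f t - l) N.+1) + (wvar n N (f t - l) + w * nm ((f t - l) N.+1 - (f t - l) N)) < e).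
rewrite mulrDr dw in wincr; lra.
Qed.

End Tails.

(** * The algebra and its seminorms *)

Section Space.
Context {R : realType}.
Local Notation nm := (@Normc.normc R).
Implicit Types x y z : nat -> R[i]^o.

Definition bv x : Prop :=
  (forall n, exists C, forall N, qnorm n N x <= C) /\
  (forall e : R, 0 < e -> exists K, forall k, (K <= k)%N -> nm (x k) <= e).

Definition bv_mem : {pred (nat -> R[i]^o)} := fun x => `[< bv x >].

Lemma bv_memP x : reflect (bv x) (x \in bv_mem).
Proof. exact: asboolP. Qed.

Lemma bv_submod : submod_closed bv_mem.
Proof.
split.
  apply/bv_memP; split=> [n|e e0].
    exists 0 => N; rewrite -(scale0r (0 : nat -> R[i]^o)) qnormZ Normc.normc0 mul0r //.
  by exists 0%N => k _; rewrite Normc.normc0 ltW.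
move=> c x y /bv_memP [xb x0] /bv_memP [yb y0]; apply/bv_memP; split=> [n|e e0].
  have [C Cx] := xb n; have [D Dy] := yb n; exists (nm c * C + D) => N.
  by apply: le_trans (qnormD _ _ _ _) _; rewrite qnormZ lerD // ler_wpM2l ?normc_ge0.
have c1 : 0 < nm c + 1 by rewrite ltr_wpDl ?normc_ge0.
have [|K Kx] := x0 (e / 2 / (nm c + 1)); first by rewrite !divr_gt0.
have [|L Ly] := y0 (e / 2); first by rewrite divr_gt0.
exists (maxn K L) => k; rewrite geq_max => /andP[/Kx xk /Ly yk].
apply: le_trans (le_normcD _ _) _; rewrite [e]splitr lerD //.
have -> : nm ((c *: x) k) = nm c * nm (x k) := Normc.normcM _ _.
rewrite ler_pdivlMr // in xk; apply: le_trans xk; rewrite mulrC ler_wpM2l ?normc_ge0 //.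
by rewrite lerDl.
Qed.

HB.instance Definition _ := GRing.isSubmodClosed.Build _ _ bv_mem bv_submod.

Record bvseq := BVSeq { bvfun :> nat -> R[i]^o; _ : bvfun \in bv_mem }.

HB.instance Definition _ := [isSub for bvfun].
HB.instance Definition _ := [Choice of bvseq by <:].
HB.instance Definition _ := [SubChoice_isSubLmodule of bvseq by <:].

Lemma bvP (x : bvseq) : bv x.
Proof. by apply/bv_memP; case: x. Qed.

Lemma bvfunB (x y : bvseq) : bvfun (x - y) = bvfun x - bvfun y.
Proof. exact: (raddfB (val : bvseq -> _)). Qed.

End Space.
Section Norms.
Context {R : realType}.
Local Notation nm := (@Normc.normc R).
Implicit Types x y z : @bvseq R.

(** Since [qnorm n N x] increases with [N] and [x] tends to 0, this is the full weighted variation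
    of [x]. *)
Definition bvnorm n x : R := sup (range (fun N => qnorm n N x)).

Lemma qnorm_le_bvnorm n N x : qnorm n N x <= bvnorm n x.
Proof.
apply: ub_le_sup; last by exists N.
have [C Cx] := (bvP x).1 n.
by exists C => _ [M _ <-].
Qed.

Lemma bvnorm_le n x C : (forall N, qnorm n N x <= C) -> bvnorm n x <= C.
Proof.
move=> xC; apply: ge_sup; first by exists (qnorm n 0 x), 0%N.
by move=> _ [N _ <-].
Qed.

Lemma normc_le_bvnorm n N x : nm (x N) <= bvnorm n x.
Proof. exact: le_trans (normc_le_qnorm n N x) (qnorm_le_bvnorm n N x). Qed.

Lemma bvfunZ c x : bvfun (c *: x) = c *: bvfun x.
Proof. by []. Qed.

Lemma bvnorm_seminorm :
  seminorm_sequence (fun n (x : @bvseq R) => (bvnorm n x)%:C%C : R[i]).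
Proof.
split.
- by move=> n x; rewrite ler0c (le_trans (qnorm_ge0 n 0 x)) ?qnorm_le_bvnorm.
- move=> n x y; rewrite -rmorphD /= lecR; apply: bvnorm_le => N.
  by apply: le_trans (qnormD _ _ _ _) _; rewrite lerD ?qnorm_le_bvnorm.
- have Zle n (c : R[i]) x : bvnorm n (c *: x) <= nm c * bvnorm n x.
    apply: bvnorm_le => N; rewrite bvfunZ qnormZ.
    by rewrite ler_wpM2l ?normc_ge0 ?qnorm_le_bvnorm.
  move=> n c x; rewrite -[RHS](rmorphM (real_complex R) (nm c)); congr (_%:C%C).
  apply/eqP; rewrite eq_le Zle /=; have [->|c0] := eqVneq c 0.
    by rewrite Normc.normc0 mul0r (le_trans (qnorm_ge0 n 0 (0 *: x))) ?qnorm_le_bvnorm.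
  have c_gt0 : 0 < nm c by rewrite -ltcR -normr_normc normr_gt0.
  have := Zle n c^-1 (c *: x); rewrite scalerA mulVf // scale1r.
  by rewrite Normc.normcV ler_pdivlMl.
- move=> n x; rewrite lecR; apply: bvnorm_le => N.
  exact: le_trans (qnorm_le _ _ _) (qnorm_le_bvnorm _ _ _).
Qed.

Definition bvalg : tvsType R[i] := seminormed bvnorm_seminorm.

Lemma nbhs0_bvP (U : set bvalg) : nbhs 0 U <->
  exists n, exists2 r : R, 0 < r & forall x : bvalg, bvnorm n x < r -> U x.
Proof.
split=> [/nbhs0_snormP [n [_ [/gt0_complexE [r r0 ->] rU]]]|[n [r r0 rU]]].
  by exists n, r => // x xr; apply: rU; rewrite ltcR.
apply/nbhs0_snormP; exists n, r%:C%C; split; first by rewrite ltcR.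
by move=> x; rewrite ltcR; exact: rU.
Qed.

Lemma nbhs0_bvball n (r : R) : 0 < r -> nbhs (0 : bvalg) [set x : bvalg | bvnorm n x < r].
Proof. by move=> r0; apply/nbhs0_bvP; exists n, r. Qed.

Lemma bv_mul x y : bv (fun k => x k * y k).
Proof.
split=> [n|e e0].
  exists (bvnorm n x * bvnorm n y) => N; apply: le_trans (qnorm_mul _ _ _ _) _.
  by rewrite ler_pM ?qnorm_ge0 ?qnorm_le_bvnorm.
have c1 : 0 < bvnorm 0 y + 1.
  by rewrite ltr_wpDl // (le_trans (qnorm_ge0 0 0 y)) ?qnorm_le_bvnorm.
have [|K Kx] := (bvP x).2 (e / (bvnorm 0 y + 1)); first by rewrite divr_gt0.
exists K => k /Kx xk; have -> : nm (x k * y k) = nm (x k) * nm (y k) := Normc.normcM _ _.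
rewrite ler_pdivlMr // in xk; apply: le_trans xk; rewrite ler_wpM2l ?normc_ge0 //.
by apply: le_trans (normc_le_bvnorm 0 k y) _; rewrite lerDl.
Qed.

Definition bvmul (x y : bvalg) : bvalg := BVSeq (introT (bv_memP _) (bv_mul x y)).

Lemma bvseqP x y : (forall k, x k = y k) -> x = y.
Proof. by move=> xy; apply: val_inj; apply/funext => k; exact: xy. Qed.

Lemma bvmul_bilinear : bilinear_map bvmul.
Proof.
split=> [x c y z|z c x y]; apply: bvseqP => k.
  by rewrite /= mulrDr; congr (_ + _); exact: mulrCA.
by rewrite /= mulrDl; congr (_ + _); rewrite -mulrA.
Qed.

Lemma bvmul_bvnorm n (x y : bvalg) : bvnorm n (bvmul x y) <= bvnorm n x * bvnorm n y.
Proof.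
apply: bvnorm_le => N; apply: le_trans (qnorm_mul _ _ _ _) _.
by rewrite ler_pM ?qnorm_ge0 ?qnorm_le_bvnorm.
Qed.

Lemma bvmulC : commutative bvmul.
Proof. by move=> x y; apply: bvseqP => k; exact: mulrC. Qed.

Lemma bvmulA : associative bvmul.
Proof. by move=> x y z; apply: bvseqP => k; exact: mulrA. Qed.

End Norms.

(** * Completeness *)

Section Completeness.
Context {R : realType}.
Local Notation nm := (@Normc.normc R).
Local Notation bvalg := (@bvalg R).

Lemma qnormB n N (x y : nat -> R[i]^o) : qnorm n N (x - y) = qnorm n N (y - x).
Proof.
rewrite -opprB -scaleN1r qnormZ (_ : nm (-1) = 1) ?mul1r //.
by rewrite normcN Normc.normc1.
Qed.

Lemma bvalg_complete : lmod_complete bvalg.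
Proof.
move=> F FF Fc.
have ballF n (e : R) : 0 < e -> exists2 B : set bvalg, F B &
    forall x y : bvalg, B x -> B y -> bvnorm n (x - y) < e.
  by move=> e0; exact: (Fc _ (nbhs0_bvball n e0)).
have /choice [l Fl] : forall k, exists c, forall e : R, 0 < e ->
    F [set x : bvalg | nm (bvfun x k - c) < e].
  move=> k; apply: complex_cauchy_limit => e /(ballF 0%N) [B FB Be].
  exists B => // x y Bx By; apply: le_lt_trans (Be x y Bx By).
  exact: (normc_le_bvnorm 0 k (x - y : bvalg)).
(* The set [B] comes from the Cauchy condition and serves all [N] at once; only the auxiliary [y]
   depends on [N]. *)
have Fnear n (e : R) : 0 < e -> exists2 B : set bvalg, F B &
    forall x : bvalg, B x -> forall N, qnorm n N (bvfun x - l) <= e.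
  move=> e0; have e2 : 0 < e / 2 by rewrite divr_gt0.
  have [B FB Be] := ballF n _ e2; exists B => // x Bx N.
  have [y [By /= yl]] := filter_ex (filterI FB (qnorm_limit Fl n N e2)).
  rewrite -[bvfun x - l](subrKA (bvfun y)); apply: le_trans (qnormD _ _ _ _) _.
  rewrite [e]splitr lerD ?(ltW yl) //; apply: le_trans (ltW (Be x y Bx By)).
  exact: (qnorm_le_bvnorm n N (x - y : bvalg)).
have lP : bv l.
  split=> [n|e e0].
    have [B FB Bl] := Fnear n 1 ltr01; have [x Bx] := filter_ex FB.
    exists (bvnorm n x + 1) => N; rewrite -[l](subrK (bvfun x)) addrC.
    apply: le_trans (qnormD _ _ _ _) _.
    by rewrite qnormB lerD ?qnorm_le_bvnorm ?Bl.
  have e2 : 0 < e / 2 by rewrite divr_gt0.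
  have [B FB Bl] := Fnear 0%N _ e2; have [x Bx] := filter_ex FB.
  have [K xK] := (bvP x).2 _ e2; exists K => k /xK xk.
  apply: le_trans (normc_le_add _ (bvfun x k)) _; rewrite [e]splitr lerD // normcB.
  exact: le_trans (normc_le_qnorm 0 k (bvfun x - l)) (Bl x Bx k).
pose L : bvalg := BVSeq (introT (bv_memP _) lP).
exists L; apply/cvg0P => U /nbhs0_bvP [n [r r0 rU]].
have r2 : 0 < r / 2 by rewrite divr_gt0.
have [B FB Bl] := Fnear n _ r2; apply: filterS FB => x Bx; apply: rU.
apply: le_lt_trans (bvnorm_le (C := r / 2) _) _; first exact: Bl Bx.
by rewrite ltr_pdivrMr // ltr_pMr // ltr1n.
Qed.

Lemma bvalg_frechet : is_frechet bvalg.
Proof.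
apply: snorm_frechet; [exact: complex_invn_cvg0| |exact: bvalg_complete].
move=> x x0; apply: bvseqP => k; apply: Normc.eq0_normc; apply/eqP.
rewrite eq_le normc_ge0 andbT; apply: le_trans (normc_le_bvnorm 0 k x) _.
by rewrite -lecR x0.
Qed.

Lemma bvalg_arens_michael : frechet_arens_michael_algebra (@bvmul R).
Proof.
split; first split.
- exact: bvalg_frechet.
- exact: bvmul_bilinear.
- exact: bvmulA.
- apply: snorm_mul_continuous; first exact: bvmul_bilinear.
  by move=> n x y; rewrite -(rmorphM (real_complex R)) /= lecR bvmul_bvnorm.
exists (range (fun n (x : bvalg) => (bvnorm n x)%:C%C)); split; last first.
  exact: snorm_topology_given_by.
move=> _ [n _ <-]; split; first by case: (@bvnorm_seminorm R) => h0 hD hZ _; split.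
by move=> x y; rewrite -(rmorphM (real_complex R)) /= lecR bvmul_bvnorm.
Qed.

End Completeness.

(** * Truncated units, approximate identities and the Montel property *)

Section Units.
Context {R : realType}.
Local Notation nm := (@Normc.normc R).
Local Notation bvalg := (@bvalg R).

Lemma qnorm_fin n K N (x : nat -> R[i]^o) : (forall k, (K <= k)%N -> x k = 0) ->
  qnorm n N x <= qnorm n K x.
Proof.
move=> xK; have [KN|/ltnW/qnorm_mono //] := leqP K N.
rewrite -(subnKC KN); elim: (N - K)%N => [|j IHj]; first by rewrite addn0.
apply: le_trans IHj; rewrite addnS /qnorm wvarS !xK ?leqW ?leq_addr //.
by rewrite subrr Normc.normc0 mulr0 addr0.
Qed.

Lemma bv_fin K (x : nat -> R[i]^o) : (forall k, (K <= k)%N -> x k = 0) -> bv x.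
Proof.
move=> xK; split=> [n|e e0]; first by exists (qnorm n K x) => N; exact: qnorm_fin.
by exists K => k /xK ->; rewrite Normc.normc0 ltW.
Qed.

Definition bvunit_fun k : nat -> R[i]^o := fun j => if (j <= k)%N then 1 else 0.

Lemma bvunit_bv k : bv (bvunit_fun k).
Proof. by apply: (@bv_fin k.+1) => j kj; rewrite /bvunit_fun leqNgt kj. Qed.

Definition bvunit k : bvalg := BVSeq (introT (bv_memP _) (bvunit_bv k)).

Lemma wvar_bvunit n N k : wvar n N (bvunit k) = if (k < N)%N then wt n k else 0.
Proof.
elim: N => [|N IHN]; first by rewrite /wvar big_ord0.
rewrite wvarS IHN /= /bvunit_fun ltnS; case: (ltngtP N k) => Nk.
- by rewrite subrr Normc.normc0 mulr0 addr0.
- by rewrite subrr Normc.normc0 mulr0 addr0.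
- by rewrite Nk sub0r normcN Normc.normc1 mulr1 add0r.
Qed.

Lemma bvnorm_bvunit n k : bvnorm n (bvunit k) <= wt n k.
Proof.
apply: bvnorm_le => N; rewrite /qnorm wvar_bvunit /= /bvunit_fun ltnNge.
case: leqP => _; rewrite ?Normc.normc1 ?Normc.normc0 ?addr0 ?add0r //.
exact: wt_ge1.
Qed.

(** The norm of [bvunit k] is at most [wt n k], which is at most [n.+1 ^ n] for arbitrarily large
    [k]. *)
Lemma bvunit_small (O : set bvalg) : nbhs 0 O ->
  exists2 t : R[i], t != 0 & forall k0, exists2 k, (k0 <= k)%N & O (t *: bvunit k).
Proof.
move=> /nbhs0_bvP [n [r r0 rU]]; pose C : R := (n.+1 ^ n)%:R.
have C0 : 0 < C + 1 by rewrite ltr_wpDl.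
have t0 : 0 < r / (C + 1) by rewrite divr_gt0.
have nt : nm (r / (C + 1))%:C%C = r / (C + 1).
  by apply: (@complexI R); rewrite -normr_normc ger0_norm // ler0c ltW.
exists (r / (C + 1))%:C%C; first by rewrite gt_eqF // ltcR.
move=> k0; have [k k0k kC] := wbase_exp_small n k0; exists k => //; apply: rU.
apply: (@le_lt_trans _ _ (r / (C + 1) * C)).
  apply: bvnorm_le => N; rewrite bvfunZ qnormZ nt ler_pM2l //.
  apply: le_trans (qnorm_le_bvnorm n N (bvunit k)) _.
  by apply: le_trans (bvnorm_bvunit n k) _; rewrite ler_nat.
by rewrite mulrAC ltr_pdivrMr // ltr_pM2l // ltrDl.
Qed.

Lemma bvmul_bvunit (d : bvalg) K : (forall k, (K <= k)%N -> bvfun d k = 0) ->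
  forall k, (K <= k)%N -> bvmul d (bvunit k) = d.
Proof.
move=> dK k Kk; apply: bvseqP => j; rewrite /= /bvunit_fun.
have [jk|kj] := leqP j k; first exact: mulr1.
rewrite dK ?mul0r //; exact: leq_trans Kk (ltnW kj).
Qed.

Lemma bvunit_dense (a : bvalg) :
  closure [set d | exists k0, forall k, (k0 <= k)%N -> bvmul d (bvunit k) = d] a.
Proof.
apply/closure0P => U /nbhs0_bvP [n [r r0 rU]].
have r4 : 0 < r / 4 by rewrite divr_gt0.
have [K0 K0P] := uniform_tail (fun m => bvnorm m a) n r4.
have [K1 K1P] := (bvP a).2 _ r4; pose K := maxn K0 K1.
(* Subtracting [a K] before truncating avoids a jump at [K] with uncontrolled weight: the difference
   [z] is constant up to [K] and follows [- a] from there on. *)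
pose d k : R[i]^o := if (k < K)%N then bvfun a k - bvfun a K else 0.
have d0 k : (K <= k)%N -> d k = 0 by rewrite /d leqNgt => /negbTE ->.
pose D : bvalg := BVSeq (introT (bv_memP _) (bv_fin d0)).
exists D; first by exists K; exact: bvmul_bvunit.
apply: rU; pose z : nat -> R[i]^o := d - bvfun a.
have zl k : (k <= K)%N -> z k = - bvfun a K.
  rewrite leq_eqVlt /z => /orP [/eqP ->|kK].
    by change (d K - bvfun a K = - bvfun a K); rewrite d0 // sub0r.
  by change (d k - bvfun a k = - bvfun a K); rewrite /d kK addrAC subrr sub0r.
have zr k : (K <= k)%N -> z k = - bvfun a k.
  by move=> /d0 dk; change (d k - bvfun a k = - bvfun a k); rewrite dk sub0r.
have zK : wvar n K z = 0.
  rewrite /wvar big1 // => -[k kK] _ /=; rewrite !zl ?(ltnW kK) //.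
  by rewrite subrr Normc.normc0 mulr0.
have ztail N : (K <= N)%N -> wvar n N z = wvar n K z + (wvar n N a - wvar n K a).
  move=> KN; rewrite -(subnKC KN); elim: (N - K)%N => [|j IHj].
    by rewrite addn0 subrr addr0.
  rewrite addnS !wvarS IHj !zr ?leqW ?leq_addr // -opprD.
  by rewrite normcN; ring.
apply: (@le_lt_trans _ _ (r / 4 + r / 4 *+ 2)); last by lra.
apply: bvnorm_le => N; rewrite bvfunB -/z.
apply: le_trans (qnorm_tail (K := K) (ltW r4) _) _ => [KN|].
  rewrite ztail // lerD2l lerBlDl; apply: K0P KN _; first exact: leq_maxl.
  by move=> m N'; exact: qnorm_le_bvnorm.
by rewrite lerD2r /qnorm zK addr0 zl // normcN K1P // leq_maxr.
Qed.

Lemma bvnorm_bounded (B : set bvalg) : tvs_bounded B ->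
  exists C : nat -> R, forall x m, B x -> bvnorm m x <= C m.
Proof.
move=> Bb; have /choice [C BC] : forall m, exists c : R, forall x, B x -> bvnorm m x <= c.
  move=> m; have [c Bc] := snorm_bounded m Bb; exists (complex.Re c) => x /Bc.
  by rewrite lecE /= => /andP [].
by exists C => x m; exact: BC.
Qed.

Lemma bvalg_no_bai : ~ has_bounded_approximate_identity (@bvmul R).
Proof.
move=> [I [le [e [[[i0 _] lerefl _ _] eb ea _]]]].
have [C eC] := bvnorm_bounded eb.
have q0 : 0 < (1 / 4 : R) by rewrite divr_gt0.
have [K KP] := uniform_tail C 0%N q0.
(* [K] is chosen before [i]. The sequence [e i] is at most 1/4 at some far index, which depends on
   [i], and varies by at most 1/4 between [K] and that index. *)
have coord i : nm (bvfun (e i) K) <= 1 / 2.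
  have [L Le] := (bvP (e i)).2 _ q0.
  have KM : (K <= maxn K L)%N := leq_maxl _ _.
  have ri : range e (e i) by exists i.
  have tailK := KP K (maxn K L) (bvfun (e i)) (leqnn _) KM
    (fun m N => le_trans (qnorm_le_bvnorm m N (e i)) (eC (e i) m ri)).
  have := wvar_incr 0%N (bvfun (e i)) KM.
  have := normc_le_add (bvfun (e i) K) (bvfun (e i) (maxn K L)); rewrite normcB.
  have := Le _ (leq_maxr K L); lra.
have h0 : 0 < (1 / 2 : R) by rewrite divr_gt0.
have uU : nbhs (bvunit K) [set y : bvalg | bvnorm 0 (y - bvunit K) < 1 / 2].
  apply/nbhs_shift; apply: filterS (nbhs0_bvball 0%N h0) => y /=.
  by rewrite addrAC subrr add0r.
have [i /(_ i (lerefl i)) /= ei] := ea _ _ uU.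
have := normc_le_bvnorm 0%N K (bvmul (bvunit K) (e i) - bvunit K : bvalg).
rewrite bvfunB; change (nm (bvunit_fun K K * bvfun (e i) K - bvunit_fun K K) <=
  bvnorm 0 (bvmul (bvunit K) (e i) - bvunit K : bvalg) -> False).
rewrite /bvunit_fun leqnn mul1r => /le_lt_trans /(_ ei).
have := normc_le_add 1 (bvfun (e i) K); rewrite normcB Normc.normc1.
have := coord i; lra.
Qed.

(** Along an ultrafilter on [closure B] the bounded coordinates converge; uniform tails upgrade this
    to the Cauchy property, and completeness gives the limit. *)
Lemma bvalg_montel : montel bvalg.
Proof.
move=> B /bvnorm_bounded [C BC]; rewrite compact_ultra => F FU FB.
have clC (x : bvalg) m : closure B x -> bvnorm m x <= C m + 1.
  move=> /closure0P /(_ _ (nbhs0_bvball m ltr01)) [b Bb /= bx].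
  apply: bvnorm_le => N; apply: le_trans (_ : _ <= qnorm m N b + qnorm m N (bvfun x - bvfun b)) _.
    by rewrite -{1}[bvfun x](subrK (bvfun b)) addrC; exact: qnormD.
  rewrite lerD //; first exact: le_trans (qnorm_le_bvnorm m N b) (BC b m Bb).
  rewrite qnormB -bvfunB; apply: le_trans (qnorm_le_bvnorm m N _) _; exact: ltW.
have /choice [l Fl] : forall k, exists c, forall e : R, 0 < e ->
    F [set x : bvalg | nm (bvfun x k - c) < e].
  move=> k; apply: (@complex_ultra_limit _ _ F _ _ (C 0%N + 1)).
  by apply: filterS FB => x /(clC x 0%N); apply: le_trans; exact: normc_le_bvnorm.
have [|p Fp] := bvalg_complete (F := F).
  move=> U /nbhs0_bvP [n [r r0 rU]].
  have r8 : 0 < r / 8 by rewrite divr_gt0.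
  (* Tails are needed for differences of two elements of [closure B], each bounded by [C m + 1]. *)
  have [K KP] := uniform_tail (fun m => (C m + 1) + (C m + 1)) n r8.
  exists (closure B `&` [set x : bvalg | qnorm n K (bvfun x - l) < r / 8]).
    by apply: filterI FB _; exact: qnorm_limit.
  move=> x y [Bx xl] [By yl]; apply: rU.
  apply: (@le_lt_trans _ _ (r / 8 + r / 8 + r / 8 *+ 2)); last by lra.
  have xyq m N : qnorm m N (bvfun x - bvfun y) <= (C m + 1) + (C m + 1).
    apply: le_trans (qnormD _ _ _ _) _; rewrite -sub0r qnormB subr0 lerD //.
      exact: le_trans (qnorm_le_bvnorm m N x) (clC x m Bx).
    exact: le_trans (qnorm_le_bvnorm m N y) (clC y m By).
  apply: bvnorm_le => N; rewrite bvfunB.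
  apply: le_trans (qnorm_tail (K := K) (ltW r8) _) _ => [KN|].
    exact: KP (leqnn _) KN xyq.
  rewrite lerD2r -[bvfun x - _](subrKA l); apply: le_trans (qnormD _ _ _ _) _.
  by rewrite lerD // ?(qnormB _ _ l) ltW.
exists p; split => //.
by apply: (closed_cvg (F := F) (u_ := id) (closure B) (@closed_closure _ _) _ p Fp).
Qed.

End Units.

Theorem corollary10p5 (R : realType) :
  exists (A : tvsType R[i]) (mul : A -> A -> A),
    [/\ frechet_arens_michael_algebra mul,
        commutative mul,
        strictly_flat mul (trivial_act mul),
        ~ has_bounded_approximate_identity mul
      & montel A].
Proof.
exists (@bvalg R), (@bvmul R); split.
- exact: bvalg_arens_michael.
- exact: bvmulC.
- exact: (strictly_flat_trivial complex_invn_cvg0 (@bvunit_dense R)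
    (@bvunit_small R) frechet_complex).
- exact: bvalg_no_bai.
- exact: bvalg_montel.
Qed.
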